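(* Let $X_{1,j}$, $j\in\mathbb{N}$, be zero-mean random elements of separable Hilbert spaces $H_{1,j}$, $j\in\mathbb{N}$, respectively, with $\mathbb{E}\|X_{1,j}\|_{H_{1,j}}^2<\infty$, and let $K^{X_{1,j}}$ be the covariance operator of $X_{1,j}$. Let $(\lambda^{X_{1,j}}_k)_{k\in\mathbb{N}}$ be the non-increasing sequence of eigenvalues of $K^{X_{1,j}}$ (counted with multiplicity, and extended by zeros if $H_{1,j}$ is finite-dimensional), and assume $\lambda^{X_{1,j}}_1>0$ for all $j\in\mathbb{N}$. Put $\Lambda^{X_{1,j}}=\sum_{k=1}^\infty\lambda^{X_{1,j}}_k$ and $\bar\lambda^{X_{1,j}}_k=\lambda^{X_{1,j}}_k/\Lambda^{X_{1,j}}$, $k,j\in\mathbb{N}$. For every $d\in\mathbb{N}$ let $X_d=\otimes_{j=1}^d X_{1,j}$, i.e. $X_d$ is a zero-mean random element of the Hilbertian tensor product $H_d=\otimes_{j=1}^d H_{1,j}$ with covariance operator $K^{X_d}=\otimes_{j=1}^d K^{X_{1,j}}$. The sequence of approximation problems for $X_d$, $d\in\mathbb{N}$, is quasi-polynomially tractable if and only if both of the following conditions hold: $$\sup_{d\in\mathbb{N}}\ \frac{1}{\ln_+ d}\sum_{j=1}^{d}\sum_{k=2}^{\infty}\bigl(1+|\ln\bar\lambda^{X_{1,j}}_k|\bigr)\,\bar\lambda^{X_{1,j}}_k<\infty,\qquad (\mathrm{i})$$ $$\sup_{d\in\mathbb{N}}\ \sum_{j=1}^{d}\sum_{k=2}^{\infty}\bigl(\bar\lambda^{X_{1,j}}_k\bigr)^{1-\frac{\gamma}{\ln_+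 d}}\,\mathbf{1}\bigl(\bar\lambda^{X_{1,j}}_k<e^{-\tau\ln_+ d}\bigr)<\infty\qquad (\mathrm{ii})$$ for some $\gamma\in(0,1)$ and for some (or, equivalently, each) $\tau>0$. That is, the following three assertions are equivalent: (a) quasi-polynomial tractability holds; (b) (i) holds, and (ii) holds for some $\gamma\in(0,1)$ and some $\tau>0$; (c) (i) holds, and there is $\gamma\in(0,1)$ such that (ii) holds for every $\tau>0$.
   Context: $\mathbb{N}$ is the set of positive integers. $\ln_+ x=\max\{1,\ln x\}$ for $x>0$. $\mathbf{1}(A)$ equals $1$ if the proposition $A$ is true and $0$ otherwise. Convention: $|\ln 0|\cdot 0=0$. For a zero-mean random element $X_d$ of a separable Hilbert space $H_d$ with $\mathbb{E}\|X_d\|_{H_d}^2<\infty$, let $$e^{X_d}(n)=\inf\Bigl\{\bigl(\mathbb{E}\|X_d-\widetilde X\|_{H_d}^2\bigr)^{1/2}:\ \widetilde X=\sum_{m=1}^n l_m(X_d)\psi_m,\ \psi_m\in H_d,\ l_m\in H_d^*\Bigr\},\quad n\in\mathbb{N},$$ where $H_d^*$ is the space of continuous linear functionals on $H_d$, and $e^{X_d}(0)=(\mathbb{E}\|X_d\|_{H_d}^2)^{1/2}$. The average case approximation complexity is $$n^{X_d}(\varepsilon)=\min\{n\in\mathbb{N}:\ e^{X_d}(n)\leqslant\varepsilon\,e^{X_d}(0)\},\qquad \varepsilon\in(0,1).$$ Equivalently, if $(\lambda^{X_d}_k)_{k\in\mathbb{N}}$ is the non-increasing sequence of eigenvalues of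 $K^{X_d}$ (extended by zeros in the finite-dimensional case) and $\Lambda^{X_d}=\sum_{k}\lambda^{X_d}_k$, then $n^{X_d}(\varepsilon)=\min\{n\in\mathbb{N}:\sum_{k=n+1}^\infty\lambda^{X_d}_k\leqslant\varepsilon^2\Lambda^{X_d}\}$. For $X_d=\otimes_{j=1}^d X_{1,j}$ the sequence $(\lambda^{X_d}_k)_{k\in\mathbb{N}}$ is the non-increasing ordering of the products $\prod_{j=1}^d\lambda^{X_{1,j}}_{k_j}$, $k_1,\dots,k_d\in\mathbb{N}$. The sequence of approximation problems for $X_d$, $d\in\mathbb{N}$, is called quasi-polynomially tractable if there are numbers $C>0$ and $s\geqslant 0$ such that $$n^{X_d}(\varepsilon)\leqslant C\exp\bigl\{s(1+\ln\varepsilon^{-1})(1+\ln d)\bigr\}\quad\text{for all } d\in\mathbb{N},\ \varepsilon\in(0,1).$$ *)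

(* Defs.v *)
From HB Require Import structures.
From mathcomp Require Import all_boot all_order all_algebra.
From mathcomp Require Import sesquilinear.
From mathcomp Require Import all_classical all_reals all_analysis.

Set Implicit Arguments.
Unset Strict Implicit.
Unset Printing Implicit Defensive.

Import Order.TTheory GRing.Theory Num.Theory.
Import numFieldNormedType.Exports.

Local Open Scope classical_set_scope.
Local Open Scope ring_scope.

(* Conventions. Hilbert spaces are real. The one-based indices j (factors) and
   k (eigenvalues) are shifted to start at 0, so [mu j k] is the (k+1)-st term
   of the sequence of the (j+1)-st factor and a sum over k >= 2 becomes
   [\sum_(1 <= k <oo)]. The dimension d is not shifted. *)

Record sepHilbertType (R : realType) := SepHilbertType {
  hilbert_sort :> completeNormedModType R;
  hilbert_dot : {dot hilbert_sort for idfun};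
  hilbert_normE : forall x : hilbert_sort, `|x| ^+ 2 = hilbert_dot x x;
  hilbert_separable : exists2 D : set hilbert_sort, countable D & dense D }.

Notation hdot := (hilbert_dot _).

(* Since E|X| is finite, X has mean zero iff E<X, x> = 0 for every x. *)
Record random_element (R : realType) (H : sepHilbertType R) := RandomElement {
  re_display : measure_display;
  re_space : measurableType re_display;
  re_prob : probability re_space R;
  re_fun :> re_space -> H;
  re_measurable :
    measurable_fun [set: re_space] (re_fun : _ -> g_sigma_algebraType (@open H));
  re_square_integrable : ('E_re_prob[fun w => (`|re_fun w| ^+ 2)%R] < +oo)%E;
  re_zero_mean : forall x : H, ('E_re_prob[fun w => hdot (re_fun w) x] = 0)%E }.

Section HilbertSpace.
Context {R : realType} {H : sepHilbertType R}.
Implicit Type (X : random_element H) (K : H -> H).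

Definition covariance_operator X K :=
  forall x y : H,
    (hdot (K x) y)%:E = 'E_(re_prob X)[fun w => (hdot (X w) x * hdot (X w) y)%R]%E.

Definition lin_indep n (u : 'I_n -> H) :=
  forall a : 'I_n -> R, \sum_i a i *: u i = 0 -> forall i, a i = 0.

(* Every nonzero v occurs in lam exactly dim ker (K - v) times: n occurrences
   can be selected iff there are n linearly independent eigenvectors. This
   determines lam; in particular lam is padded with zeros when K has finite
   rank. *)
Definition eigenvalue_sequence K (lam : nat -> R) :=
  nonincreasing_seq lam /\
  forall v : R, v != 0 -> forall n : nat,
    (exists2 u : 'I_n -> H, lin_indep u & forall i, K (u i) = v *: u i) <->
    (exists2 k : 'I_n -> nat, injective k & forall i, lam (k i) = v).

(* e^X(n) for n >= 1. *)
Definition approx_error X (n : nat) : R :=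
  inf [set e | exists (l : 'I_n -> {scalar H}) (psi : 'I_n -> H),
         (forall m, continuous (l m : H -> R)) /\
         e = Num.sqrt (fine 'E_(re_prob X)[fun w =>
               (`|X w - \sum_(m < n) l m (X w) *: psi m| ^+ 2)%R]%E)].

(* e^X(0). *)
Definition initial_error X : R :=
  Num.sqrt (fine 'E_(re_prob X)[fun w => (`|X w| ^+ 2)%R]%E).

(* The infimum of a nonempty set of naturals is its minimum; it would be +oo
   if no n were admissible. *)
Definition approx_complexity X (eps : R) : \bar R :=
  ereal_inf [set n%:R%:E | n in
    [set n : nat | (0 < n)%N /\ approx_error X n <= eps * initial_error X]].

End HilbertSpace.

(* Up to isometry, the Hilbertian tensor product of the H i, with T x the
   elementary tensor of the x i: the inner product is the product one and the
   elementary tensors span a dense subspace. Multilinearity of T follows from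
   the first clause. *)
Definition hilbert_tensor_product (R : realType) (I : finType)
    (H : I -> sepHilbertType R) (HT : sepHilbertType R)
    (T : (forall i, H i) -> HT) :=
  (forall x y, hdot (T x) (T y) = \prod_i hdot (x i) (y i)) /\
  dense [set v : HT | exists n (a : 'I_n -> R) (x : 'I_n -> forall i, H i),
           v = \sum_m a m *: T (x m)].

Definition quasi_polynomially_tractable (R : realType)
    (H : nat -> sepHilbertType R) (X : forall d, random_element (H d)) :=
  exists C s : R, [/\ 0 < C, 0 <= s &
    forall (d : nat) (eps : R), (0 < d)%N -> 0 < eps < 1 ->
      (approx_complexity (X d) eps
         <= (C * expR (s * (1 + ln eps^-1) * (1 + ln d%:R)))%:E)%E].

Section Conditions.
Context {R : realType}.

Definition lnp (x : R) : R := Num.max 1 (ln x).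

Definition normalized (lam : nat -> R) (k : nat) : R :=
  lam k / limn (series lam).

(* The library has ln 0 = 0 and 0 `^ a = 0 for a != 0, so vanishing terms of
   mu contribute 0 to both sums. *)
Definition log_sum_condition (mu : nat -> nat -> R) :=
  (ereal_sup [set (lnp d%:R)^-1%:E *
                  \sum_(j < d) \sum_(1 <= k <oo)
                    ((1 + `|ln (mu j k)|) * mu j k)%:E
             | d in [set d : nat | (0 < d)%N]] < +oo)%E.

Definition power_sum_condition (mu : nat -> nat -> R) (gamma tau : R) :=
  (ereal_sup [set \sum_(j < d) \sum_(1 <= k <oo)
                    (mu j k `^ (1 - gamma / lnp d%:R) *
                     (mu j k < expR (- tau * lnp d%:R))%R%:R)%:E
             | d in [set d : nat | (0 < d)%N]] < +oo)%E.

End Conditions.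

(* Main.v *)
Require Import Defs.
From mathcomp Require Import all_boot all_order all_algebra.
From mathcomp Require Import all_classical all_reals all_analysis.
From mathcomp Require Import sesquilinear measurable_realfun ring lra.
Import Order.TTheory GRing.Theory Num.Theory.
Import numFieldNormedType.Exports.

(** Write [mu j] for the normalized eigenvalues of the [j]-th factor, a probability
    distribution on the naturals, and [p] for a product of one weight per factor
    [j < d]; these [p] are the normalized eigenvalues of the tensor product.

    Tractability concerns how fast the ordered [p] decay, but they need not be
    sorted. If [n] of the [p] carry mass [1 - eps ^+ 2], projecting on their
    eigenvectors shows that the complexity is at most [n] ([tensor_error_le]).
    Conversely, if rank [n] reaches accuracy [eps], then for every [theta >= 0] the
    sum of the minima of [p] and [theta] is at most [eps ^+ 2 + n * theta]
    ([tensor_error_ge], from the Ky Fan bound [ky_fan]). This needs the identity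
    between the sum of the eigenvalues and the second moment
    ([eigenvalue_series_cvg]), whose proof contains the part of the spectral
    theorem that is used: a compact positive form attains its maximum on the unit
    ball, at an eigenvector ([top_eigenvector]).

    From the two bounds, quasi-polynomial tractability is equivalent to the
    existence of [delta] in (0, 1) for which the sums of the powers
    [p `^ (1 - delta / lnp d)] are bounded uniformly in [d]
    ([products_of_complexity], [complexity_of_products]). Such a sum is an
    exponential moment of the information [- ln p], which is a sum of [d]
    independent contributions, so it factors into the product over [j < d] of the
    sums of [mu j k `^ (1 - delta / lnp d)].

    Each factor of this product is [1] plus an excess, so the product is bounded
    exactly when the sum of the excesses is. The excess of a weight is comparable
    to the term of [log_sum_condition], divided by [lnp d], as long as the weight
    is above the threshold [expR (- tau * lnp d)], and to the term of
    [power_sum_condition] below it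
    ([log_sum_of_products], [power_sum_of_products], [products_of_sums]). The
    threshold is arbitrary and the same exponent [delta] serves as [gamma], hence
    some [tau] may be replaced by each [tau]. *)

Set Implicit Arguments.
Unset Strict Implicit.
Unset Printing Implicit Defensive.

Local Open Scope classical_set_scope.
Local Open Scope ring_scope.

(** * Inner products and positive semidefinite forms *)

Section InnerProduct.
Context {R : realType} {H : sepHilbertType R}.
Implicit Types x y z : H.

Lemma hdotC x y : hdot x y = hdot y x.
Proof. by rewrite [LHS]hermC expr0 mul1r. Qed.

Lemma hdotDl x y z : hdot (x + y) z = hdot x z + hdot y z.
Proof. by rewrite linearDl. Qed.

Lemma hdotBl x y z : hdot (x - y) z = hdot x z - hdot y z.
Proof. by rewrite linearBl. Qed.

Lemma hdotZl a x z : hdot (a *: x) z = a * hdot x z.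
Proof. by rewrite linearZl_LR. Qed.

Lemma hdot0l z : hdot 0 z = 0.
Proof. by rewrite linear0l. Qed.

Lemma hdot_suml I (r : seq I) (P : pred I) (F : I -> H) z :
  hdot (\sum_(i <- r | P i) F i) z = \sum_(i <- r | P i) hdot (F i) z.
Proof. by rewrite linear_sumlz. Qed.

Lemma hdotDr x y z : hdot x (y + z) = hdot x y + hdot x z.
Proof. by rewrite ![hdot x _]hdotC hdotDl. Qed.

Lemma hdotBr x y z : hdot x (y - z) = hdot x y - hdot x z.
Proof. by rewrite ![hdot x _]hdotC hdotBl. Qed.

Lemma hdotZr a x z : hdot x (a *: z) = a * hdot x z.
Proof. by rewrite ![hdot x _]hdotC hdotZl. Qed.

Lemma hdot0r z : hdot z 0 = 0.
Proof. by rewrite hdotC hdot0l. Qed.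

Lemma hdot_sumr I (r : seq I) (P : pred I) (F : I -> H) z :
  hdot z (\sum_(i <- r | P i) F i) = \sum_(i <- r | P i) hdot z (F i).
Proof. by rewrite hdotC hdot_suml; apply: eq_bigr => i _; rewrite hdotC. Qed.

Lemma hdot_ge0 x : 0 <= hdot x x.
Proof. by rewrite -hilbert_normE exprn_ge0. Qed.

Lemma hdot_eq0 x : (hdot x x == 0) = (x == 0).
Proof. by rewrite -hilbert_normE sqrf_eq0 normr_eq0. Qed.

Lemma hdot_inj x y : (forall z, hdot x z = hdot y z) -> x = y.
Proof.
move=> h; apply/eqP; rewrite -subr_eq0 -hdot_eq0 hdotBl.
by rewrite h subrr.
Qed.


(** Zero vectors are allowed, so that Gram-Schmidt applied to dependent
    vectors, eigenvectors attached to padding zeros and families padded to a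
    prescribed length all remain of this kind. *)
Definition orthonormal0 (I : eqType) (e : I -> H) :=
  (forall i j, i != j -> hdot (e i) (e j) = 0) /\
  (forall i, e i = 0 \/ hdot (e i) (e i) = 1).

Lemma orthonormal0_comp (I J : eqType) (f : J -> I) (e : I -> H) :
  injective f -> orthonormal0 e -> orthonormal0 (e \o f).
Proof.
move=> f_inj [eo e1]; split=> [i j ij|i /=]; last exact: e1.
by apply: eo; rewrite (inj_eq f_inj).
Qed.

Section Finite.
Context {I : finType}.
Variable e : I -> H.
Hypothesis eO : orthonormal0 e.

(** Makes every formula for orthonormal families valid without distinguishing
    the zero members. *)
Lemma orthonormal0_normM x i : hdot x (e i) * hdot (e i) (e i) = hdot x (e i).
Proof. by case: (eO.2 i) => ->; rewrite ?hdot0r ?mul0r ?mulr1. Qed.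

Lemma orthonormal0_norm_le1 i : hdot (e i) (e i) <= 1.
Proof. by case: (eO.2 i) => ->; rewrite ?hdot0r. Qed.

Lemma orthonormal0_coord (c : I -> R) i :
  hdot (\sum_j c j *: e j) (e i) = c i * hdot (e i) (e i).
Proof.
rewrite hdot_suml (bigD1 i) //= hdotZl big1 ?addr0 // => j ji.
by rewrite hdotZl eO.1 ?mulr0.
Qed.

Lemma orthonormal0_dist x (c : I -> R) :
  `|x - \sum_i c i *: e i| ^+ 2 =
  `|x| ^+ 2 - \sum_i hdot x (e i) ^+ 2 +
  \sum_i (hdot x (e i) - c i) ^+ 2 * hdot (e i) (e i).
Proof.
set S := \sum_i _ *: _; rewrite !hilbert_normE hdotBl !hdotBr (hdotC S x).
have -> : hdot x S = \sum_i c i * hdot x (e i).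
  by rewrite hdot_sumr; apply: eq_bigr => i _; rewrite hdotZr.
have -> : hdot S S = \sum_i c i ^+ 2 * hdot (e i) (e i).
  rewrite {2}/S hdot_sumr; apply: eq_bigr => i _.
  by rewrite hdotZr orthonormal0_coord; ring.
rewrite opprB addrA -!addrA; congr (_ + _).
rewrite -!sumrN -!big_split; apply: eq_bigr => i _ /=.
have := orthonormal0_normM x i.
by case: (eO.2 i) => ->; rewrite ?hdot0r => _; ring.
Qed.

Definition oproj x := \sum_i hdot x (e i) *: e i.

Lemma oproj_dist x :
  `|x - oproj x| ^+ 2 = `|x| ^+ 2 - \sum_i hdot x (e i) ^+ 2.
Proof.
rewrite orthonormal0_dist [X in _ + X]big1 ?addr0 // => i _.
by rewrite subrr expr0n mul0r.
Qed.

Lemma bessel x : \sum_i hdot x (e i) ^+ 2 <= `|x| ^+ 2.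
Proof. by rewrite -subr_ge0 -oproj_dist exprn_ge0. Qed.

(** The error of projecting onto the span is the smallest possible; this is the
    source of all lower bounds on approximation errors. *)
Lemma oproj_best x (c : I -> R) :
  `|x| ^+ 2 - \sum_i hdot x (e i) ^+ 2 <= `|x - \sum_i c i *: e i| ^+ 2.
Proof.
rewrite orthonormal0_dist lerDl; apply: sumr_ge0 => i _.
by rewrite mulr_ge0 ?sqr_ge0 ?hdot_ge0.
Qed.

Lemma hdot_oproj x i : hdot (oproj x) (e i) = hdot x (e i).
Proof. by rewrite orthonormal0_coord orthonormal0_normM. Qed.

Lemma norm_oproj (c : I -> R) :
  `|\sum_i c i *: e i| ^+ 2 = \sum_i c i ^+ 2 * hdot (e i) (e i).
Proof.
rewrite hilbert_normE hdot_sumr; apply: eq_bigr => i _.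
by rewrite hdotZr orthonormal0_coord; ring.
Qed.

End Finite.
End InnerProduct.

Section PsdForm.
Context {R : realType} {V : lmodType R}.

Definition psd_form (b : V -> V -> R) :=
  [/\ (forall a x y z, b (a *: x + y) z = a * b x z + b y z),
      (forall x y, b x y = b y x) & forall x, 0 <= b x x].

Section Theory.
Variable b : V -> V -> R.
Hypothesis b_psd : psd_form b.

Lemma psdC x y : b x y = b y x.
Proof. by have [_ ->] := b_psd. Qed.

Lemma psd_ge0 x : 0 <= b x x.
Proof. by have [_ _ ->] := b_psd. Qed.

Lemma psdDl x y z : b (x + y) z = b x z + b y z.
Proof. by have [bl _ _] := b_psd; rewrite -[x in LHS]scale1r bl mul1r. Qed.

Lemma psd0l z : b 0 z = 0.
Proof. by apply/(addrI (b 0 z)); rewrite -psdDl !addr0. Qed.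

Lemma psdZl a x z : b (a *: x) z = a * b x z.
Proof. by have [bl _ _] := b_psd; rewrite -[a *: x]addr0 bl psd0l addr0. Qed.

Lemma psdBl x y z : b (x - y) z = b x z - b y z.
Proof. by rewrite -scaleN1r psdDl psdZl mulN1r. Qed.

Lemma psdDr x y z : b z (x + y) = b z x + b z y.
Proof. by rewrite psdC psdDl !(psdC z). Qed.

Lemma psdZr a x z : b z (a *: x) = a * b z x.
Proof. by rewrite psdC psdZl psdC. Qed.

Lemma psdBr x y z : b z (x - y) = b z x - b z y.
Proof. by rewrite psdC psdBl !(psdC z). Qed.

Lemma psd_parallelogram x y :
  b (x + y) (x + y) + b (x - y) (x - y) = 2 * b x x + 2 * b y y.
Proof. by rewrite psdBl psdDl !psdBr !psdDr (psdC y x); ring. Qed.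

(** Nonnegativity of [b] at [b y y *: x - b x y *: y] gives the claim after
    division by [b y y]; when [b y y = 0], a large multiple of [y] shows that
    [b x y] has to vanish. *)
Lemma psd_cauchy_schwarz x y : b x y ^+ 2 <= b x x * b y y.
Proof.
have q s t : b (s *: x + t *: y) (s *: x + t *: y) =
    s ^+ 2 * b x x + s * t * b x y *+ 2 + t ^+ 2 * b y y.
  by rewrite psdDl !psdDr !psdZl !psdZr (psdC y x); ring.
have [y0|y0] := eqVneq (b y y) 0; last first.
  have yp : 0 < b y y by rewrite lt_def y0 psd_ge0.
  have := psd_ge0 (b y y *: x + (- b x y) *: y); rewrite q.
  have -> : b y y ^+ 2 * b x x + b y y * - b x y * b x y *+ 2 +
    (- b x y) ^+ 2 * b y y = b y y * (b x x * b y y - b x y ^+ 2) by ring.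
  by rewrite pmulr_rge0 // subr_ge0.
rewrite y0 mulr0; have [->|xy0] := eqVneq (b x y) 0; first by rewrite expr0n.
have := psd_ge0 (1 *: x + (- ((b x x + 1) / (2 * b x y))) *: y); rewrite q y0.
have -> : 1 ^+ 2 * b x x + 1 * - ((b x x + 1) / (2 * b x y)) * b x y *+ 2 +
  (- ((b x x + 1) / (2 * b x y))) ^+ 2 * 0 = -1 by field.
by rewrite oppr_ge0 ler10.
Qed.

End Theory.
End PsdForm.

Section Hilbert.
Context {R : realType} {H : sepHilbertType R}.
Implicit Types x y z : H.

Lemma hdot_psd : psd_form (hilbert_dot H).
Proof.
split=> [a x y z|x y|x]; [|exact: hdotC|exact: hdot_ge0].
by rewrite hdotDl hdotZl.
Qed.

Lemma hdot_cauchy_schwarz x y : `|hdot x y| <= `|x| * `|y|.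
Proof.
rewrite -(@ler_pXn2r _ 2) ?nnegrE ?mulr_ge0 //.
rewrite exprMn !hilbert_normE real_normK ?num_real //.
exact: (psd_cauchy_schwarz hdot_psd).
Qed.

Lemma hdot_continuous y : continuous (hdot y : H -> R).
Proof.
apply/linear_bounded_continuous/linear_boundedP.
near=> r => x; apply: le_trans (hdot_cauchy_schwarz _ _) _.
by rewrite ler_wpM2r //; near: r; apply: nbhs_pinfty_ge; rewrite num_real.
Unshelve. all: by end_near. Qed.

Lemma hdotl_continuous y : continuous (fun x : H => hdot x y).
Proof.
have -> : (fun x : H => hdot x y) = hdot y by apply/funext=> x; exact: hdotC.
exact: hdot_continuous.
Qed.

End Hilbert.

(** * Complete orthonormal systems *)

(** Gram-Schmidt and the choice of eigenvectors both determine each vector from all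
    of its predecessors. *)
Lemma course_of_values_rec T (f : seq T -> T) :
  exists u : nat -> T, forall n, u n = f [seq u i | i <- iota 0 n].
Proof.
pose s := fix s n := if n is m.+1 then rcons (s m) (f (s m)) else [::].
exists (fun n => f (s n)) => n; congr f.
elim: n => // n IH.
by rewrite -[in RHS]addn1 iotaD map_cat -IH add0n cats1.
Qed.

Section Basis.
Context {R : realType} {H : sepHilbertType R}.
Implicit Types x y z : H.

Lemma gram_schmidt (v : nat -> H) :
  exists2 e : nat -> H, orthonormal0 e & forall n, exists c : nat -> R,
    forall N, (n < N)%N -> v n = \sum_(i < N) c i *: e i.
Proof.
pose res (s : seq H) u : H := u - \sum_(w <- s) hdot u w *: w.
pose nrm u : H := `|u|^-1 *: u.
have [e eE'] := course_of_values_rec (fun s => nrm (res s (v (size s)))).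
pose r i : H := v i - \sum_(j < i) hdot (v i) (e j) *: e j.
have eE i : e i = `|r i|^-1 *: r i.
  rewrite eE' /nrm /res size_map size_iota big_map.
  have -> : iota 0 i = index_iota 0 i by rewrite /index_iota subn0.
  by rewrite big_mkord.
have e1 i : e i = 0 \/ hdot (e i) (e i) = 1.
  rewrite eE; have [->|r0] := eqVneq (r i) 0; first by rewrite scaler0; left.
  right; rewrite -hilbert_normE normrZ normfV normr_id mulVf ?normr_eq0 //.
  by rewrite expr1n.
have eO n : forall i j, (i < n)%N -> (j < n)%N -> i != j ->
    hdot (e i) (e j) = 0.
  elim: n => // n IH.
  have new j : (j < n)%N -> hdot (e n) (e j) = 0.
    move=> jn; rewrite eE hdotZl /r hdotBl.
    have eO' : orthonormal0 (e \o val : 'I_n -> H).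
      by split=> [a b ab|a]; [exact: (IH _ _ (ltn_ord a) (ltn_ord b))|exact: e1].
    by rewrite (hdot_oproj eO' (v n) (Ordinal jn)) subrr mulr0.
  move=> i j; rewrite !ltnS leq_eqVlt => /predU1P[->|i_n];
    rewrite leq_eqVlt => /predU1P[->|j_n]; rewrite ?eqxx // => ij.
  - exact: new.
  - by rewrite hdotC new.
  - exact: IH.
exists e; first by split=> // i j; apply: (eO (maxn i j).+1);
  rewrite ltnS ?leq_maxl ?leq_maxr.
move=> n.
exists (fun i => if (i < n)%N then hdot (v n) (e i) else `|r n| *+ (i == n)).
move=> N nN; rewrite -(big_mkord xpredT (fun i => (if (i < n)%N then
  hdot (v n) (e i) else `|r n| *+ (i == n)) *: e i)).
rewrite (big_cat_nat (n := n.+1)) //= big_nat_recr //= ltnn eqxx.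
rewrite [X in _ + X]big_nat_cond [X in _ + X]big1 ?addr0; last first.
  move=> i /andP[/andP[ni _] _]; rewrite ltnNge (ltnW ni) /=.
  by rewrite gtn_eqF ?mulr0n ?scale0r.
rewrite mulr1n [e n]eE scalerA.
have -> : (`|r n| * `|r n|^-1) *: r n = r n.
  have [->|r0] := eqVneq (r n) 0; first by rewrite scaler0.
  by rewrite divff ?normr_eq0 // scale1r.
rewrite big_mkord /r addrC.
under [X in _ + X]eq_bigr do rewrite ltn_ord.
by rewrite subrK.
Qed.

(** Completeness is expressed by Parseval's identity. *)
Definition complete_system (e : nat -> H) := forall x,
  (fun N : nat => \sum_(i < N) hdot x (e i) ^+ 2) @ \oo --> `|x| ^+ 2.

Lemma dense_sequence : exists v : nat -> H, dense (range v).
Proof.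
have [D /countable_injP[f f_inj] Dd] := hilbert_separable H.
have [d0 [_ Dd0]] : [set: H] `&` D !=set0.
  by apply: Dd; [exists 0|exact: openT].
pose v n := if pselect (exists2 x, D x & f x = n) is left h
  then sval (cid2 h) else d0.
have vf x : D x -> v (f x) = x.
  move=> Dx; rewrite /v; case: pselect => [h|[]]; last by exists x.
  case: (cid2 h) => y Dy /= fy; apply: f_inj => //; exact/mem_set.
exists v => O O0 Oo; have [x [Ox Dx]] := Dd O O0 Oo.
by exists x; split=> //; exists (f x) => //; exact: vf.
Qed.

(** Gram-Schmidt on a dense sequence: every vector is close to a finite
    combination of the system, and projecting does at least as well. *)
Lemma complete_system_exists :
  exists2 e : nat -> H, orthonormal0 e & complete_system e.
Proof.
have [v vd] := dense_sequence; have [e eO ev] := gram_schmidt v.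
exists e => // x; apply/cvgrPdist_lt => eps eps0.
have eps'0 : 0 < Num.sqrt eps by rewrite sqrtr_gt0.
have [_ [] /[swap] -[n _ <-]] := vd _ (ex_intro _ x (ballxx x eps'0))
  (ball_open x (Num.sqrt eps)).
move=> xv; have {}xv : ball x (Num.sqrt eps) (v n) := xv.
rewrite -ball_normE /= in xv; have [c vE] := ev n.
exists n.+1 => // N /= nN.
have eON : orthonormal0 (e \o val : 'I_N -> H).
  exact: orthonormal0_comp val_inj eO.
rewrite ger0_norm ?subr_ge0 ?(bessel eON) //.
apply: le_lt_trans (oproj_best eON x (c \o val)) _.
rewrite -vE // -[eps]sqr_sqrtr ?ltW // ltr_pXn2r ?nnegrE //.
Qed.

End Basis.

(** * Eigenvectors of compact forms *)

Section Weak.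
Context {R : realType} {H : sepHilbertType R}.
Implicit Types x y z : H.

(** Compactness of a segment, for ultrafilters on the domain of a bounded
    function. It replaces the extraction of weakly convergent subsequences. *)
Lemma ultra_bounded_cvg {T} (U : set_system T) (UU : UltraFilter U)
    (f : T -> R) (a b : R) :
  U [set x | a <= f x <= b] -> exists l : R, f @ U --> l.
Proof.
move=> Uf; have PU : ProperFilter U := ultra_proper.
have [l [_ fl]] : `[a, b]%classic `&` cluster (f @ U) !=set0.
  have Uab : U (f @^-1` `[a, b]) by apply: filterS Uf => x; rewrite /= in_itv.
  exact: segment_compact Uab.
exists l => A Al.
have [//|UA] := in_ultra_setVsetC (f @^-1` A) UU.
by have [r []] := fl (~` A) A UA Al.
Qed.

(** Completeness of the space enters here: the partial sums of
    [c i *: e i] are Cauchy because their squared norms are nondecreasing and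
    bounded. *)
Lemma orthonormal_series (e : nat -> H) (c : nat -> R) B :
  orthonormal0 e ->
  (forall N : nat, \sum_(i < N) c i ^+ 2 * hdot (e i) (e i) <= B) ->
  exists2 w : H, `|w| ^+ 2 <= B &
    forall i, hdot w (e i) = c i * hdot (e i) (e i).
Proof.
move=> eO sB; pose s N := \sum_(i < N) c i ^+ 2 * hdot (e i) (e i).
pose W N := \sum_(i < N) c i *: e i.
have eON N : orthonormal0 (e \o val : 'I_N -> H).
  exact: orthonormal0_comp val_inj eO.
have We N i : (i < N)%N -> hdot (W N) (e i) = c i * hdot (e i) (e i).
  by move=> iN; rewrite -(orthonormal0_coord (eON N) (c \o val) (Ordinal iN)).
have WN N : `|W N| ^+ 2 = s N by rewrite (norm_oproj (eON N) (c \o val)).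
have Wd N M : (N <= M)%N -> `|W M - W N| ^+ 2 = s M - s N.
  move=> NM; have WMN : hdot (W M) (W N) = s N.
    rewrite {2}/W hdot_sumr; apply: eq_bigr => i _.
    by rewrite hdotZr We ?(leq_trans (ltn_ord i)) //; ring.
  rewrite hilbert_normE hdotBl !hdotBr (hdotC (W N) (W M)) WMN.
  by rewrite -!hilbert_normE !WN; ring.
have s_nd : {homo s : n m / (n <= m)%N >-> n <= m}.
  by move=> n m nm; rewrite -subr_ge0 -Wd // exprn_ge0.
have s_cvg : cvgn s.
  by apply: nondecreasing_is_cvgn => //; exists B => _ [N _ <-]; exact: sB.
have W_cvg : cvg (W @ \oo).
  apply/cauchy_cvgP/cauchy_exP => eps eps0.
  have eps20 : 0 < eps ^+ 2 by rewrite exprn_gt0.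
  have /cvgrPdist_lt/(_ _ eps20) [N _ hN] := s_cvg.
  exists (W N); exists N => // M /= NM.
  rewrite -ball_normE /= distrC -(@ltr_pXn2r _ 2) ?nnegrE ?normr_ge0 ?(ltW eps0) //.
  rewrite Wd //; apply: le_lt_trans (hN N (leqnn _)).
  by apply: le_trans (ler_norm _); rewrite lerD2r nondecreasing_cvgn_le.
have /cvg_ex[/= w Ww] := W_cvg; exists w.
  have : (fun N => `|W N| ^+ 2) @ \oo --> `|w| ^+ 2.
    rewrite expr2; under eq_fun do rewrite expr2.
    by apply: cvgM; apply: cvg_norm.
  apply: (closed_cvg (fun t : R => t <= B)); first exact: closed_le.
  by near=> N; rewrite /= WN; exact: sB.
move=> i; have : hdot (W N) (e i) @[N --> \oo] --> hdot w (e i).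
  exact: (cvg_comp W (fun x => hdot x (e i)) Ww (hdotl_continuous (y := e i) (x := w))).
move/(cvg_lim (@Rhausdorff R)) => <-; apply: lim_near_cst => //.
by near=> N; apply: We; near: N; exact: nbhs_infty_gt.
Unshelve. all: by end_near. Qed.

(** Compactness of the operator of the form, in the shape used here: the form is
    uniformly small on the orthogonal complement of finitely many [e i]. *)
Definition compact_form (e : nat -> H) (b : H -> H -> R) :=
  forall eta : R, 0 < eta -> exists N : nat, forall y,
    (forall i : 'I_N, hdot y (e i) = 0) -> b y y <= eta * `|y| ^+ 2.

Section Top.
Variables (e : nat -> H) (b : H -> H -> R) (C : R).
Hypotheses (eO : orthonormal0 e) (b_psd : psd_form b).
Hypotheses (b_bnd : forall x, b x x <= C * `|x| ^+ 2) (b_cpt : compact_form e b).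

(** Split [x - w] into its projection on the first [N] vectors of [e], which
    tends to zero by coordinatewise convergence, and the rest, on which the form
    is uniformly small; then [b x x - b w w = b (x - w) (x + w)] is bounded by
    Cauchy-Schwarz. *)
Lemma compact_form_weak_usc (U : set_system H) (w : H) :
  ProperFilter U -> U [set x | `|x| <= 1] -> `|w| <= 1 ->
  (forall i, hdot x (e i) @[x --> U] --> hdot w (e i)) ->
  forall eps, 0 < eps -> \forall x \near U, b x x <= b w w + eps.
Proof.
move=> PU U1 w1 xw eps eps0.
have C0 : 0 <= `|C| by [].
(* with this eta the final bound is eps ^+ 2 / 4 *)
pose eta := eps ^+ 2 / (16 * (`|C| + 1) * (`|C| + 1)).
have k0 : 0 < `|C| + 1 by rewrite ltr_wpDl.
have eta0 : 0 < eta by rewrite divr_gt0 ?exprn_gt0 // !mulr_gt0.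
have Ck : C <= `|C| + 1 by apply: le_trans (ler_norm _) _; rewrite lerDl.
have eta8 : 0 < eta / 16 by rewrite divr_gt0.
have [N bN] := b_cpt eta8.
have eON : orthonormal0 (e \o val : 'I_N -> H).
  exact: orthonormal0_comp val_inj eO.
have small : \forall x \near U, \sum_(i < N) hdot (x - w) (e i) ^+ 2 <= eta / 4.
  have : \sum_(i < N) hdot (x - w) (e i) ^+ 2 @[x --> U] -->
      \sum_(i < N) (hdot w (e i) - hdot w (e i)) ^+ 2.
    apply: cvg_big => [|i _]; first exact: add_continuous.
    under eq_fun do rewrite hdotBl expr2.
    by rewrite expr2; apply: cvgM; apply: cvgB => //; exact: cvg_cst.
  rewrite big1; last by move=> i _; rewrite subrr expr0n.
  move/cvgr0Pnorm_le => /(_ _ (divr_gt0 eta0 (ltr0n _ 4))) /=.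
  by apply: filterS => x; apply: le_trans; exact: ler_norm.
near=> x.
have x1 : `|x| <= 1 by near: x.
have xw2 : `|x - w| <= 2 by apply: le_trans (ler_normB _ _) _; lra.
have xw2' : `|x + w| <= 2 by apply: le_trans (ler_normD _ _) _; lra.
have s1 : \sum_(i < N) hdot (x - w) (e i) ^+ 2 <= eta / 4 by near: x.
have y_small : b (x - w) (x - w) <= (`|C| + 1) * eta.
  set y := x - w; pose p := oproj (e \o val : 'I_N -> H) y.
  have yE : y = (y - p) + p by rewrite subrK.
  have := psd_parallelogram b_psd (y - p) p; rewrite -yE.
  have := psd_ge0 b_psd (y - p - p).
  have /bN : forall i : 'I_N, hdot (y - p) (e i) = 0.
    by move=> i; rewrite hdotBl (hdot_oproj eON y i) subrr.
  rewrite (oproj_dist eON) => yp; have pE := b_bnd p.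
  have yy : `|y| ^+ 2 <= 2 ^+ 2 by rewrite ler_pXn2r ?nnegrE.
  have s0 : 0 <= \sum_i hdot y ((e \o val : 'I_N -> H) i) ^+ 2.
    by apply: sumr_ge0 => i _; exact: sqr_ge0.
  have s1' : \sum_i hdot y ((e \o val : 'I_N -> H) i) ^+ 2 <= eta / 4 := s1.
  have pn : `|p| ^+ 2 = \sum_i hdot y ((e \o val : 'I_N -> H) i) ^+ 2.
    rewrite /p (norm_oproj eON); apply: eq_bigr => i _.
    by rewrite expr2 -mulrA (orthonormal0_normM eON).
  rewrite pn in pE.
  have pk : C * \sum_i hdot y ((e \o val : 'I_N -> H) i) ^+ 2 <=
      (`|C| + 1) * (eta / 4).
    by apply: le_trans (ler_wpM2r s0 Ck) _; rewrite ler_pM2l.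
  have ek : eta <= (`|C| + 1) * eta by rewrite ler_peMl ?(ltW eta0) ?lerDr.
  have e8 : 0 < eta / 16 by [].
  have : eta / 16 * (`|y| ^+ 2 - \sum_i hdot y ((e \o val : 'I_N -> H) i) ^+ 2)
      <= eta / 16 * 4 by rewrite ler_pM2l //; lra.
  lra.
have xw_bnd : b (x + w) (x + w) <= (`|C| + 1) * 4.
  apply: le_trans (b_bnd _) _.
  apply: le_trans (ler_wpM2r (sqr_ge0 _) Ck) _; rewrite ler_pM2l //.
  by have : `|x + w| ^+ 2 <= 2 ^+ 2; [rewrite ler_pXn2r ?nnegrE|lra].
have := psd_cauchy_schwarz b_psd (x - w) (x + w).
have -> : b (x - w) (x + w) = b x x - b w w.
  by rewrite (psdBl b_psd) !(psdDr b_psd) (psdC b_psd w x); ring.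
move=> cs; rewrite leNgt; apply/negP => xw_gt.
have : (b x x - b w w) ^+ 2 <= eps ^+ 2 / 4.
  apply: le_trans cs _.
  apply: le_trans (ler_pM (psd_ge0 b_psd _) (psd_ge0 b_psd _) y_small xw_bnd) _.
  rewrite /eta le_eqVlt; apply/orP; left; apply/eqP; field.
  by rewrite gt_eqF.
have : eps ^+ 2 < (b x x - b w w) ^+ 2.
  by rewrite ltr_pXn2r ?nnegrE //; lra.
have : 0 < eps ^+ 2 by rewrite exprn_gt0.
lra.
Unshelve. all: by end_near. Qed.

(** The Rayleigh quotient attains its supremum [M]. A weak limit [w] of
    near-maximizers is a maximizer by upper semicontinuity, and then the
    semidefinite form [M * hdot x y - b x y] vanishes at [w], hence, by
    Cauchy-Schwarz, against every vector: [w] is an eigenvector for [M]. *)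
Lemma top_eigenvector x0 : 0 < b x0 x0 ->
  exists w : H, exists M : R, [/\ `|w| = 1, 0 < M,
    forall y, b w y = M * hdot w y & forall x, b x x <= M * `|x| ^+ 2].
Proof.
move=> bx0; pose S := [set b x x | x in [set x : H | `|x| <= 1]].
have S_sup : has_sup S.
  split; first by exists (b 0 0); exists 0 => //=; rewrite normr0.
  exists `|C| => _ [x /= x1 <-]; apply: le_trans (b_bnd x) _.
  apply: le_trans (ler_wpM2r (sqr_ge0 _) (ler_norm C)) _.
  by rewrite ler_piMr // exprn_ile1.
pose M := sup S.
have bM x : b x x <= M * `|x| ^+ 2.
  have [->|x_neq0] := eqVneq x 0.
    by rewrite (psd0l b_psd) normr0 expr0n mulr0.
  have nx : 0 < `|x| by rewrite normr_gt0.
  have : b (`|x|^-1 *: x) (`|x|^-1 *: x) <= M.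
    apply: ub_le_sup; first exact: S_sup.2.
    by exists (`|x|^-1 *: x) => //=; rewrite normrZ normfV normr_id mulVf ?gt_eqF.
  rewrite (psdZl b_psd) (psdZr b_psd) mulrA -invfM -expr2.
  by rewrite mulrC ler_pdivrMr ?exprn_gt0.
have M0 : 0 < M.
  have /lt_le_trans/(_ (bM x0)) := bx0.
  by rewrite pmulr_lgt0 // exprn_gt0 // normr_gt0; apply: contraTneq bx0 => ->;
    rewrite (psd0l b_psd) ltxx.
(* near-maximizers in the unit ball; F is refined to an ultrafilter *)
pose B (eps : R) := [set x : H | `|x| <= 1 /\ M - eps < b x x].
pose F := filter_from [set eps : R | 0 < eps] B.
have FF : Filter F.
  apply: filter_from_filter; first by exists 1 => /=.
  move=> i j /= i0 j0; exists (Num.min i j); first by rewrite /= lt_min i0.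
  move=> x [x1 xM]; split; split=> //; apply: le_lt_trans xM;
    by rewrite lerD2l lerN2 ge_min lexx ?orbT.
have PF : ProperFilter F.
  apply: filter_from_proper => eps eps0.
  by have [_ [x /= x1 <-] xM] := sup_adherent eps0 S_sup; exists x.
have [U [UU FU]] := ultraFilterLemma PF.
have PU : ProperFilter U := ultra_proper.
have UB eps : 0 < eps -> U (B eps) by move=> eps0; apply: FU; exists eps.
have U1 : U [set x | `|x| <= 1] by apply: filterS (UB 1 _) => // x [].
have /choice[c cP] : forall i, exists l : R, hdot x (e i) @[x --> U] --> l.
  move=> i; apply: (@ultra_bounded_cvg _ _ UU _ (- 1) 1).
  apply: filterS U1 => x /= x1; rewrite -ler_norml.
  apply: le_trans (hdot_cauchy_schwarz _ _) _.
  rewrite mulr_ile1 // -(@ler_pXn2r _ 2) ?nnegrE // expr1n hilbert_normE.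
  by case: (eO.2 i) => ->; rewrite ?hdot0r.
have cn i : c i * hdot (e i) (e i) = c i.
  case: (eO.2 i) => ei; rewrite ei ?mulr1 // hdot0r mulr0.
  have := cP i; rewrite ei; under eq_fun do rewrite hdot0r.
  by move=> /(cvg_lim (@Rhausdorff R)) <-; rewrite lim_cst.
have [w w1 wc] : exists2 w : H, `|w| ^+ 2 <= 1 &
    forall i, hdot w (e i) = c i * hdot (e i) (e i).
  apply: orthonormal_series => // N.
  have eON : orthonormal0 (e \o val : 'I_N -> H).
    exact: orthonormal0_comp val_inj eO.
  have : \sum_(i < N) hdot x (e i) ^+ 2 @[x --> U] --> \sum_(i < N) c i ^+ 2.
    apply: cvg_big => [|i _]; first exact: add_continuous.
    by under eq_fun do rewrite expr2; rewrite expr2; apply: cvgM.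
  under [X in X <= _]eq_bigr do rewrite expr2 -mulrA cn -expr2.
  apply: (closed_cvg (fun t : R => t <= 1)); first exact: closed_le.
  apply: filterS U1 => x /= x1; apply: le_trans (bessel eON x) _.
  by rewrite exprn_ile1.
have w1' : `|w| <= 1 by rewrite -(@ler_pXn2r _ 2) ?nnegrE ?expr1n.
have wM : M <= b w w.
  apply/ler_addgt0Pr => eps eps0; have eps20 : 0 < eps / 2 by rewrite divr_gt0.
  have xw i : hdot x (e i) @[x --> U] --> hdot w (e i) by rewrite wc cn.
  have Uw := compact_form_weak_usc (PU UU) U1 w1' xw eps20.
  have [x [/= [_ xM] xw']] := filter_ex (filterI (UB _ eps20) Uw).
  lra.
have w_norm : `|w| = 1.
  apply/eqP; rewrite eq_le w1' /= -(@ler_pXn2r _ 2) ?nnegrE // expr1n.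
  by have := le_trans wM (bM w); rewrite ler_pMr.
exists w, M; split=> // y.
pose D x y := M * hdot x y - b x y.
have D_psd : psd_form D.
  split=> [a u v z|u v|u]; rewrite /D.
  - by rewrite hdotDl hdotZl (psdDl b_psd) (psdZl b_psd); ring.
  - by rewrite hdotC (psdC b_psd).
  - by rewrite subr_ge0 -hilbert_normE.
have Dw : D w w = 0.
  apply/eqP; rewrite eq_le psd_ge0 // andbT /D -hilbert_normE w_norm.
  by rewrite expr1n mulr1 subr_le0.
have := psd_cauchy_schwarz D_psd w y; rewrite Dw mul0r => Dwy.
have /eqP : D w y ^+ 2 = 0 by apply/eqP; rewrite eq_le Dwy sqr_ge0.
by rewrite sqrf_eq0 subr_eq0 => /eqP ->.
Qed.

End Top.
End Weak.

(** * Trace and eigenvalue sequences *)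

Lemma big_option_sum (R : nmodType) (I : finType) (F : option I -> R) :
  \sum_o F o = F None + \sum_i F (Some i).
Proof.
rewrite (bigD1 None) //=; congr (_ + _).
rewrite (reindex_omap Some id) /=; last by case.
by apply: eq_bigl => i; rewrite eqxx.
Qed.

Section Trace.
Context {R : realType} {H : sepHilbertType R}.
Implicit Types x y z : H.

(** Adjoining a unit vector; [option I] keeps the index type finite without any
    reindexing. *)
Lemma orthonormal0_option (I : finType) (f : I -> H) y :
  orthonormal0 f -> hdot y y = 1 -> (forall i, hdot y (f i) = 0) ->
  orthonormal0 (fun o : option I => if o is Some i then f i else y).
Proof.
move=> fO y1 yf; split=> [[i|] [j|] //= ij|[i|] /=].
- exact: fO.1.
- by rewrite hdotC.
- exact: fO.2.
- by right.
Qed.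

Lemma hdot_normalize y : y != 0 -> hdot (`|y|^-1 *: y) (`|y|^-1 *: y) = 1.
Proof.
move=> y0; rewrite -hilbert_normE normrZ normfV normr_id mulVf ?normr_eq0 //.
by rewrite expr1n.
Qed.

(** A positive form may be summed over any complete system; the first clause
    makes the resulting bound available for incomplete families too. *)
Definition has_trace (b : H -> H -> R) (tau : R) :=
  (forall (I : finType) (f : I -> H), orthonormal0 f ->
     \sum_i b (f i) (f i) <= tau) /\
  (forall e : nat -> H, orthonormal0 e -> complete_system e ->
     (fun N : nat => \sum_(i < N) b (e i) (e i)) @ \oo --> tau).

Section Form.
Variables (b : H -> H -> R) (tau : R).
Hypotheses (b_psd : psd_form b) (b_tr : has_trace b tau).

Lemma has_trace_bound x : b x x <= tau * `|x| ^+ 2.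
Proof.
have [->|x_neq0] := eqVneq x 0.
  by rewrite (psd0l b_psd) normr0 expr0n mulr0.
have nx : 0 < `|x| by rewrite normr_gt0.
have := b_tr.1 unit (fun=> `|x|^-1 *: x).
rewrite big_const card_unit /= addr0 (psdZl b_psd) (psdZr b_psd) mulrA -invfM.
rewrite -expr2 mulrC ler_pdivrMr ?exprn_gt0 //; apply.
split=> [[] [] //|[]]; right.
exact: hdot_normalize.
Qed.

(** What the members of [f] leave of the trace bounds the form on their
    orthogonal complement, since the normalized [y] can be adjoined to [f]. *)
Lemma has_trace_orthogonal (I : finType) (f : I -> H) y : orthonormal0 f ->
  (forall i, hdot y (f i) = 0) ->
  b y y <= (tau - \sum_i b (f i) (f i)) * `|y| ^+ 2.
Proof.
move=> fO yf; have [->|y_neq0] := eqVneq y 0.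
  by rewrite (psd0l b_psd) normr0 expr0n mulr0.
have ny : 0 < `|y| by rewrite normr_gt0.
have gO : orthonormal0 (fun o : option I =>
    if o is Some i then f i else `|y|^-1 *: y).
  apply: orthonormal0_option => // [|i]; first exact: hdot_normalize.
  by rewrite hdotZl yf mulr0.
have := b_tr.1 _ _ gO.
rewrite big_option_sum /= (psdZl b_psd) (psdZr b_psd) mulrA -invfM -expr2.
by rewrite -lerBrDr mulrC ler_pdivrMr ?exprn_gt0.
Qed.

Lemma has_trace_compact (e : nat -> H) : orthonormal0 e -> complete_system e ->
  compact_form e b.
Proof.
move=> eO eC eta eta0.
have /cvgrPdist_lt/(_ _ eta0) [N _ /(_ N (leqnn N)) /= hN] := b_tr.2 e eO eC.
exists N => y ye; have eN := orthonormal0_comp (@ord_inj N) eO.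
apply: le_trans (has_trace_orthogonal eN ye) _.
rewrite ler_wpM2r ?exprn_ge0 //; apply: le_trans (ltW hN); exact: ler_norm.
Qed.

Section EigenFamily.
Context {I : finType}.
Variables (w : I -> H) (L : I -> R).
Hypotheses (wO : orthonormal0 w) (bw : forall k y, b (w k) y = L k * hdot (w k) y).

(** Eigenvectors are orthogonal for [b] as well, so removing their span removes
    exactly their contribution. *)
Lemma psd_residual x :
  b (x - oproj w x) (x - oproj w x) = b x x - \sum_k L k * hdot x (w k) ^+ 2.
Proof.
set p := oproj w x.
have bp y : b p y = \sum_k hdot x (w k) * (L k * hdot (w k) y).
  rewrite /p /oproj; elim/big_rec2: _ => [|i r z _ <-]; first exact: psd0l.
  by rewrite (psdDl b_psd) (psdZl b_psd) bw.
rewrite (psdBl b_psd) !(psdBr b_psd) (psdC b_psd x p) !bp.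
set A := \sum_k _; set B := \sum_k _.
have <- : A = B.
  by apply: eq_bigr => k _; rewrite (hdotC _ p) (hdot_oproj wO x k) (hdotC (w k)).
rewrite subrr subr0; congr (_ - _); apply: eq_bigr => k _.
by rewrite (hdotC (w k)); ring.
Qed.

End EigenFamily.
End Form.

Section Eigen.
Variables (K : H -> H) (lam : nat -> R) (tau : R).
Let b x y := hdot (K x) y.
Hypotheses (b_psd : psd_form b) (b_tr : has_trace b tau).
Hypothesis K_lam : eigenvalue_sequence K lam.

Lemma eigenvectorP v x : K x = v *: x <-> forall y, b x y = v * hdot x y.
Proof.
split=> [Kx y|h]; first by rewrite /b Kx hdotZl.
by apply: hdot_inj => y; rewrite hdotZl -h.
Qed.

Lemma lin_indep_orthonormal n (f : 'I_n -> H) :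
  orthonormal0 f -> (forall i, f i != 0) -> lin_indep f.
Proof.
move=> fO f0 a a0 i.
have : hdot (\sum_j a j *: f j) (f i) = 0 by rewrite a0 hdot0l.
rewrite (orthonormal0_coord fO); case: (fO.2 i) => [fi|->].
  by have := f0 i; rewrite fi eqxx.
by rewrite mulr1.
Qed.

Lemma eigenvalue_ge0 k : 0 <= lam k.
Proof.
rewrite leNgt; apply/negP => lk0.
have /K_lam.2/(_ 1%N) [_ h] : lam k != 0 by rewrite lt_eqF.
have [|u uI /(_ ord0) Ku] := h.
  by exists (fun=> k) => // i j _; rewrite !ord1.
have u0 : u ord0 != 0.
  apply/eqP => u0; have := uI (fun=> 1); rewrite big_ord1 u0 scaler0.
  by move=> /(_ erefl ord0)/eqP; rewrite oner_eq0.
have := psd_ge0 b_psd (u ord0); rewrite /b Ku hdotZl.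
rewrite nmulr_rge0 // -hilbert_normE => u1.
have : 0 < `|u ord0| ^+ 2 by rewrite exprn_gt0 // normr_gt0.
by rewrite ltNge u1.
Qed.

Lemma eigenvectors_orthogonal v v' x y :
  v != v' -> K x = v *: x -> K y = v' *: y -> hdot x y = 0.
Proof.
move=> vv' /eigenvectorP Kx /eigenvectorP Ky.
have /eqP := psdC b_psd x y; rewrite Kx Ky (hdotC y) -subr_eq0 -mulrBl.
by rewrite mulf_eq0 subr_eq0 (negPf vv') => /eqP.
Qed.

(** Let [m] be the number of indices [i < n] with [lam i = lam n]. Index [n]
    itself is one more, so the eigenspace contains [m.+1] independent vectors, and
    some nonzero combination of them is orthogonal to the [m] given eigenvectors;
    those with another eigenvalue are orthogonal to it anyway. *)
Lemma next_eigenvector n (u : nat -> H) :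
  (forall i, (i < n)%N -> K (u i) = lam i *: u i) ->
  exists w : H, [/\ K w = lam n *: w, hdot w w = (lam n != 0)%:R &
    forall i, (i < n)%N -> hdot w (u i) = 0].
Proof.
move=> Ku; have [l0|l0] := eqVneq (lam n) 0.
  exists 0; split=> [||i _]; rewrite ?hdot0l ?scaler0 //.
  by apply: hdot_inj => y; rewrite [LHS](psd0l b_psd) hdot0l.
(* indices below n sharing the eigenvalue; n :: s witnesses multiplicity m.+1 *)
pose s := [seq i <- iota 0 n | lam i == lam n]; pose m := size s.
have s_uniq : uniq (n :: s).
  by rewrite /= filter_uniq ?iota_uniq // mem_filter mem_iota ltnn !andbF.
have [w wI Kw] : exists2 w : 'I_m.+1 -> H,
    lin_indep w & forall i, K (w i) = lam n *: w i.
  apply/(K_lam.2 _ l0); exists (fun i => nth 0%N (n :: s) i).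
    by move=> i j /eqP; rewrite nth_uniq // => /eqP/val_inj.
  move=> i; have : nth 0%N (n :: s) i \in n :: s by apply: mem_nth.
  by rewrite inE mem_filter => /predU1P[->//|/andP[/eqP]].
pose A := \matrix_(i < m.+1, j < m) hdot (w i) (u (nth 0%N s j)).
have kA : kermx A != 0.
  rewrite kermx_eq0 /row_free; apply/negP => /eqP rA.
  by have := rank_leq_col A; rewrite rA ltnn.
pose a := nz_row (kermx A).
have a0 : a != 0 by rewrite nz_row_eq0.
have aA : a *m A = 0 by apply/sub_kermxP; exact: nz_row_sub.
pose W := \sum_i a ord0 i *: w i.
have W0 : W != 0.
  apply/eqP => /wI a00; case/eqP: a0; apply/rowP => i.
  by rewrite mxE a00.
have KW : K W = lam n *: W.
  apply/eigenvectorP => y.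
  have -> : b W y = \sum_i b (a ord0 i *: w i) y.
    rewrite /W; elim/big_rec2: _ => [|i r z _ <-]; first exact: psd0l.
    exact: psdDl.
  rewrite /W hdot_suml mulr_sumr; apply: eq_bigr => i _.
  by rewrite (psdZl b_psd) /b Kw !hdotZl; ring.
have Wu i : (i < n)%N -> hdot W (u i) = 0.
  move=> i_n; have [li|li] := eqVneq (lam i) (lam n); last first.
    by rewrite hdotC; apply: (eigenvectors_orthogonal li) => //; exact: Ku.
  have /(nthP 0%N) [j jm ji] : i \in s by rewrite mem_filter li eqxx mem_iota.
  have /rowP/(_ (Ordinal jm)) := aA; rewrite !mxE => <-.
  rewrite hdot_suml; apply: eq_bigr => k _.
  by rewrite hdotZl mxE ji.
exists (`|W|^-1 *: W); split=> [||i /Wu]; last by rewrite hdotZl => ->; rewrite mulr0.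
  apply/eigenvectorP => y; rewrite (psdZl b_psd) /b KW !hdotZl; ring.
exact: hdot_normalize.
Qed.

(** Choosing the zero vector when [lam k = 0] makes the sequence total and keeps
    it orthonormal up to zeros. *)
Lemma eigensystem_exists : exists u : nat -> H,
  [/\ orthonormal0 u, forall k, K (u k) = lam k *: u k &
      forall k, hdot (u k) (u k) = (lam k != 0)%:R].
Proof.
have /choice[f fP] : forall p : nat * (nat -> H), exists w,
    (forall i, (i < p.1)%N -> K (p.2 i) = lam i *: p.2 i) ->
    [/\ K w = lam p.1 *: w, hdot w w = (lam p.1 != 0)%:R &
    forall i, (i < p.1)%N -> hdot w (p.2 i) = 0].
  move=> -[n u] /=.
  have [Ku|nKu] := pselect (forall i, (i < n)%N -> K (u i) = lam i *: u i).
    by have [w wP] := next_eigenvector Ku; exists w.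
  by exists 0.
have [u uE] := course_of_values_rec (fun s => f (size s, nth 0 s)).
have nth_u n i : (i < n)%N -> nth 0 [seq u j | j <- iota 0 n] i = u i.
  by move=> i_n; rewrite (nth_map 0%N) ?size_iota // nth_iota.
have uP n : [/\ K (u n) = lam n *: u n, hdot (u n) (u n) = (lam n != 0)%:R &
    forall i, (i < n)%N -> hdot (u n) (u i) = 0].
  elim/ltn_ind: n => n IH; rewrite uE size_map size_iota.
  have [|Kf f1 fu] := fP (n, nth 0 [seq u j | j <- iota 0 n]).
    by move=> i /= i_n; rewrite nth_u //; have [] := IH i i_n.
  by split=> // i i_n; rewrite -(nth_u n i i_n); exact: fu.
exists u; split=> [|k|k]; [|by have [] := uP k|by have [] := uP k].
split=> [i j|i].
  rewrite neq_ltn => /orP[ij|ji]; first rewrite hdotC.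
    by have [_ _ ->] := uP j.
  by have [_ _ ->] := uP i.
have [_ ui _] := uP i; case: (eqVneq (lam i) 0) ui => [_|_] ui; last by right.
by left; apply/eqP; rewrite -hdot_eq0 ui.
Qed.

Section System.
Variable u : nat -> H.
Hypotheses (uO : orthonormal0 u) (Ku : forall k, K (u k) = lam k *: u k).
Hypothesis u1 : forall k, hdot (u k) (u k) = (lam k != 0)%:R.

(** The form of the operator from which the first [n] eigenvectors have been
    removed. *)
Definition deflated n x y :=
  b x y - \sum_(k < n) lam k * hdot x (u k) * hdot y (u k).

Lemma deflatedE n x : let p := oproj (u \o val : 'I_n -> H) x in
  deflated n x x = b (x - p) (x - p).
Proof.
move=> p; have unO : orthonormal0 (u \o val : 'I_n -> H).
  exact: orthonormal0_comp val_inj uO.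
rewrite (@psd_residual _ b_psd _ _ (lam \o val) unO) => [|k y]; last first.
  by rewrite /b /= Ku hdotZl.
by congr (_ - _); apply: eq_bigr => k _; rewrite expr2 mulrA.
Qed.

Lemma deflated_psd n : psd_form (deflated n).
Proof.
split=> [a x y z|x y|x]; rewrite ?deflatedE ?(psd_ge0 b_psd) // /deflated.
  rewrite (psdDl b_psd) (psdZl b_psd) mulrBr mulr_sumr -addrACA -opprD.
  by rewrite -big_split; congr (_ - _); apply: eq_bigr => k _ /=;
    rewrite hdotDl hdotZl; ring.
by rewrite (psdC b_psd); congr (_ - _); apply: eq_bigr => k _; ring.
Qed.

Lemma deflated_le n x : deflated n x x <= b x x.
Proof.
rewrite /deflated gerBl; apply: sumr_ge0 => k _.
by rewrite -mulrA mulr_ge0 ?eigenvalue_ge0 // -expr2 sqr_ge0.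
Qed.

(** The Courant-Fischer bound. Otherwise the deflated form has a top eigenvector
    [w] with eigenvalue [M > lam n]. It is orthogonal to [u 0], ..., [u n.-1], so it
    is an eigenvector of [K] too, and together with the [u k] of eigenvalue [M] it
    gives one eigenvector more than [M] has occurrences in [lam], all of which
    have an index below [n]. *)
Lemma deflated_max n x : deflated n x x <= lam n * `|x| ^+ 2.
Proof.
rewrite leNgt; apply/negP => bx.
have bx0 : 0 < deflated n x x.
  by apply: le_lt_trans bx; rewrite mulr_ge0 ?eigenvalue_ge0 ?exprn_ge0.
have [e eO eC] := @complete_system_exists R H.
have cpt : compact_form e (deflated n).
  move=> eta eta0; have [N bN] := has_trace_compact b_psd b_tr eO eC eta0.
  by exists N => y /bN; apply: le_trans; exact: deflated_le.
have bnd y : deflated n y y <= tau * `|y| ^+ 2.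
  exact: le_trans (deflated_le n y) (has_trace_bound b_psd b_tr y).
have [w [M [w1 M0 wM bM]]] := top_eigenvector eO (deflated_psd n) bnd cpt bx0.
have lnM : lam n < M.
  have x0 : 0 < `|x| ^+ 2.
    rewrite exprn_gt0 // normr_gt0; apply: contraTneq bx0 => ->.
    by rewrite (psd0l (deflated_psd n)) ltxx.
  by rewrite -(ltr_pM2r x0); exact: lt_le_trans bx (bM x).
have wu k : (k < n)%N -> hdot w (u k) = 0.
  move=> kn; have := wM (u k); rewrite /deflated (bigD1 (Ordinal kn)) //= big1.
    rewrite (psdC b_psd) (proj1 (eigenvectorP _ _) (Ku k)) u1 addr0 hdotC.
    have [->|_] := eqVneq (lam k) 0 => /eqP.
      by rewrite !mul0r subr0 eq_sym mulf_eq0 gt_eqF //= hdotC => /eqP.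
    by rewrite mulr1 hdotC subrr eq_sym mulf_eq0 gt_eqF //= => /eqP.
  move=> j jk; rewrite (uO.1 k) ?mulr0 // eq_sym; apply: contra jk => /eqP jk.
  exact/eqP/val_inj.
have Kw : K w = M *: w.
  apply/eigenvectorP => y; rewrite -wM /deflated big1 ?subr0 // => k _.
  by rewrite wu // mulr0 mul0r.
pose s := [seq k <- iota 0 n | lam k == M]; pose m := size s.
have s_uniq : uniq s by rewrite filter_uniq ?iota_uniq.
have sP k : k \in s -> (k < n)%N /\ lam k = M.
  by rewrite mem_filter mem_iota => /andP[/eqP].
pose f (o : option 'I_m) := if o is Some i then u (nth 0%N s i) else w.
have fO : orthonormal0 f.
  apply: orthonormal0_option => [||i].
  - apply: (orthonormal0_comp (f := fun i : 'I_m => nth 0%N s i)) uO.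
    by move=> i j /eqP; rewrite nth_uniq // => /eqP/val_inj.
  - by rewrite -hilbert_normE w1 expr1n.
  - by apply: wu; have [] := sP _ (mem_nth 0%N (ltn_ord i)).
have [||k k_inj kM] := (K_lam.2 M _ m.+1).1; first by rewrite gt_eqF.
  exists (f \o unlift ord0).
    apply: lin_indep_orthonormal => [|i /=].
      apply: orthonormal0_comp fO => i j.
      by case: unliftP => [i' ->|->]; case: unliftP => [j' ->|->] // [->].
    case: (unlift _ _) => [j|] /=.
      have [_ jM] := sP _ (mem_nth 0%N (ltn_ord j)).
      by rewrite -hdot_eq0 u1 jM (gt_eqF M0) /= oner_eq0.
    by rewrite -normr_eq0 w1 oner_eq0.
  move=> i /=; case: (unlift _ _) => [j|] //=.
  by rewrite Ku; have [_ ->] := sP _ (mem_nth 0%N (ltn_ord j)).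
have : (size [seq k i | i <- enum 'I_m.+1] <= size s)%N.
  apply: uniq_leq_size; first by rewrite map_inj_uniq ?enum_uniq.
  move=> _ /mapP[i _ ->]; rewrite mem_filter kM eqxx mem_iota /= add0n.
  rewrite ltnNge; apply: contraTN lnM => nk; rewrite -leNgt -(kM i).
  exact: K_lam.1.
by rewrite size_map size_enum_ord ltnn.
Qed.

Lemma eigen_series_le n : series lam n <= tau.
Proof.
have unO : orthonormal0 (u \o val : 'I_n -> H).
  exact: orthonormal0_comp val_inj uO.
apply: le_trans (b_tr.1 _ _ unO); rewrite /series /= big_mkord.
apply: ler_sum => k _; rewrite /= /b Ku hdotZl u1.
by case: eqVneq => [->|_]; rewrite ?mul0r ?mulr1.
Qed.

(** The eigenvalues exhaust the trace. On the first [N] vectors of a complete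
    system the form is at most [N * lam n] (deflated part) plus the sum of the
    first [n] eigenvalues; as [lam n] tends to zero, the partial traces do not
    exceed the sum of the eigenvalues. *)
Lemma eigen_series_cvg : series lam @ \oo --> tau.
Proof.
have tau0 : 0 <= tau by have := eigen_series_le 0; rewrite /series /= big_geq.
have lam_small n : lam n * n.+1%:R <= tau.
  apply: le_trans (eigen_series_le n.+1); rewrite /series /= big_mkord.
  have -> : lam n * n.+1%:R = \sum_(i < n.+1) lam n.
    by rewrite sumr_const card_ord mulr_natr.
  by apply: ler_sum => i _; apply: K_lam.1; rewrite -ltnS.
have [e eO eC] := @complete_system_exists R H.
have key N n : \sum_(i < N) b (e i) (e i) <= N%:R * lam n + series lam n.
  have eN : orthonormal0 (e \o val : 'I_N -> H).
    exact: orthonormal0_comp val_inj eO.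
  have -> : \sum_(i < N) b (e i) (e i) = \sum_(i < N) deflated n (e i) (e i) +
     \sum_(k < n) lam k * \sum_(i < N) hdot (u k) (e i) ^+ 2.
    under [X in _ + X]eq_bigr do rewrite mulr_sumr.
    rewrite exchange_big -big_split /=; apply: eq_bigr => i _.
    rewrite /deflated
      -[LHS](subrK (\sum_(k < n) lam k * hdot (e i) (u k) * hdot (e i) (u k))).
    by congr (_ + _); apply: eq_bigr => k _; rewrite (hdotC (u k)); ring.
  apply: lerD.
    have -> : N%:R * lam n = \sum_(i < N) lam n.
      by rewrite sumr_const card_ord mulr_natl.
    apply: ler_sum => i _.
    apply: le_trans (deflated_max n _) _.
    rewrite hilbert_normE ler_piMr ?eigenvalue_ge0 //.
    exact: (orthonormal0_norm_le1 eN i).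
  rewrite /series /= big_mkord; apply: ler_sum => k _.
  rewrite ler_piMr ?eigenvalue_ge0 //; apply: le_trans (bessel eN (u k)) _.
  by rewrite hilbert_normE u1 lern1 leq_b1.
apply/cvgrPdist_le => eps eps0.
have eps20 : 0 < eps / 2 by rewrite divr_gt0.
have /cvgrPdist_le/(_ _ eps20) [N _ /(_ N (leqnn N)) /= hN] := b_tr.2 e eO eC.
near=> n; rewrite ger0_norm ?subr_ge0 ?eigen_series_le //.
have : N%:R * lam n <= eps / 2.
  have n0 : 0 < n.+1%:R :> R by rewrite ltr0n.
  rewrite -(ler_pM2r n0) -mulrA.
  apply: le_trans (ler_wpM2l (ler0n _ N) (lam_small n)) _.
  rewrite -ler_pdivrMl // mulrC; apply: (@le_trans _ _ n%:R).
    by near: n; exact: nbhs_infty_ger.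
  by rewrite ler_nat.
have := key N n; move: hN; rewrite ler_norml => /andP[]; lra.
Unshelve. all: by end_near. Qed.

End System.
End Eigen.
End Trace.

(** * Second moments and approximation errors of a random element *)

Section Moments.
Context {R : realType} {H : sepHilbertType R}.
Implicit Types (x y z : H) (g : H -> R).

(** The functions of [X] whose expectation is needed: continuity gives
    measurability and the bound gives integrability. *)
Definition quadratic_growth g :=
  continuous g /\ exists c : R, forall x, `|g x| <= c * `|x| ^+ 2.

Lemma quadratic_growthD g h : quadratic_growth g -> quadratic_growth h ->
  quadratic_growth (fun x => g x + h x).
Proof.
move=> [gc [c gb]] [hc [d hb]]; split.
  by move=> x; apply: cvgD; [exact: gc|exact: hc].
exists (c + d) => x; rewrite mulrDl; apply: le_trans (ler_normD _ _) _.
exact: lerD.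
Qed.

Lemma quadratic_growthZ (a : R) g :
  quadratic_growth g -> quadratic_growth (fun x => a * g x).
Proof.
move=> [gc [c gb]]; split; first by move=> x; apply: cvgM; [exact: cvg_cst|exact: gc].
by exists (`|a| * c) => x; rewrite normrM -mulrA ler_wpM2l.
Qed.

Lemma quadratic_growth0 : quadratic_growth (fun=> 0).
Proof.
split; first by move=> x; exact: cvg_cst.
by exists 0 => x; rewrite normr0 mul0r.
Qed.

Lemma quadratic_growth_sum (I : Type) (r : seq I) (G : I -> H -> R) :
  (forall i, quadratic_growth (G i)) ->
  quadratic_growth (fun x => \sum_(i <- r) G i x).
Proof.
move=> hG; elim: r => [|i r IH].
  by under eq_fun do rewrite big_nil; exact: quadratic_growth0.
by under eq_fun do rewrite big_cons; exact: quadratic_growthD.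
Qed.

Lemma quadratic_growth_norm : quadratic_growth (fun x => `|x| ^+ 2).
Proof.
split; last by exists 1 => x; rewrite mul1r ger0_norm ?exprn_ge0.
by move=> x; under eq_fun do rewrite expr2; apply: cvgM; exact: norm_continuous.
Qed.

Lemma quadratic_growth_dot x y : quadratic_growth (fun z => hdot z x * hdot z y).
Proof.
split; first by move=> z; apply: cvgM; exact: hdotl_continuous.
exists (`|x| * `|y|) => z; rewrite normrM expr2 mulrACA.
rewrite (mulrC `|x|) (mulrC `|y|).
by apply: ler_pM => //; exact: hdot_cauchy_schwarz.
Qed.

Variable X : random_element H.
Let P := re_prob X.

(** Preimages of open rays are open in the Hilbert space, and the Borel sets of
    the line are generated by these rays. *)
Lemma continuous_measurable g : continuous g ->
  measurable_fun [set: re_space X] (g \o X).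
Proof.
move=> gc; apply: (measurability _ (RGenOInfty.measurableE R)) => //.
move=> /= _ [_ [a ->] <-].
have : (@open H).-sigma.-measurable (g @^-1` `]a, +oo[%classic).
  apply: sub_sigma_algebra; move/continuousP: gc; apply.
  exact: interval_open.
by move=> /(@re_measurable _ _ X measurableT); rewrite comp_preimage.
Qed.

Lemma norm2_integrable : P.-integrable setT (EFin \o (fun w => `|X w| ^+ 2)).
Proof.
apply/integrableP; split.
  apply/measurable_EFinP; exact: (continuous_measurable (proj1 quadratic_growth_norm)).
have := re_square_integrable X; rewrite unlock; congr (_ < _)%E.
apply: eq_integral => w _ /=.
by rewrite ger0_norm ?exprn_ge0.
Qed.

Lemma quadratic_growth_integrable g :
  quadratic_growth g -> P.-integrable setT (EFin \o (g \o X)).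
Proof.
move=> [gc [c gb]].
have := integrableZl measurableT c norm2_integrable.
apply: le_integrable => //.
  by apply/measurable_EFinP; exact: continuous_measurable.
by move=> w _ /=; rewrite lee_fin (le_trans (gb _)) // ler_norm.
Qed.

Definition mean g : R := \int[P]_w g (X w).

Lemma expectation_mean g : quadratic_growth g ->
  'E_P[fun w => g (X w)]%E = (mean g)%:E.
Proof.
by move=> gq; rewrite unlock /mean /Rintegral fineK //;
  exact: integrable_fin_num (quadratic_growth_integrable gq).
Qed.

Lemma meanD g h : quadratic_growth g -> quadratic_growth h ->
  mean (fun x => g x + h x) = mean g + mean h.
Proof.
move=> /quadratic_growth_integrable gq /quadratic_growth_integrable hq.
exact: RintegralD.
Qed.

Lemma meanZ a g : quadratic_growth g -> mean (fun x => a * g x) = a * mean g.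
Proof. by move=> /quadratic_growth_integrable gq; exact: RintegralZl. Qed.

Lemma mean_sum (I : Type) (r : seq I) (G : I -> H -> R) :
  (forall i, quadratic_growth (G i)) ->
  mean (fun x => \sum_(i <- r) G i x) = \sum_(i <- r) mean (G i).
Proof.
move=> hG; elim: r => [|i r IH].
  rewrite big_nil /mean /Rintegral; under eq_integral do rewrite big_nil.
  by rewrite integral0.
rewrite big_cons -IH -meanD //; last exact: quadratic_growth_sum.
by congr mean; apply/funext => x; rewrite big_cons.
Qed.

Lemma le_mean g h : quadratic_growth g -> quadratic_growth h ->
  (forall x, g x <= h x) -> mean g <= mean h.
Proof.
move=> /quadratic_growth_integrable gq /quadratic_growth_integrable hq gh.
by apply: le_Rintegral => // w _; exact: gh.
Qed.

(** This is the trace of the covariance operator. *)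
Definition second_moment := mean (fun x => `|x| ^+ 2).

Lemma quadratic_growth_sum_dot (I : finType) (f : I -> H) :
  quadratic_growth (fun x => \sum_i hdot x (f i) ^+ 2).
Proof.
apply: quadratic_growth_sum => i; under eq_fun do rewrite expr2.
exact: quadratic_growth_dot.
Qed.

Lemma initial_errorE : initial_error X = Num.sqrt second_moment.
Proof. by rewrite /initial_error (expectation_mean quadratic_growth_norm). Qed.

Section Covariance.
Variable K : H -> H.
Hypothesis K_cov : covariance_operator X K.
Let b x y := hdot (K x) y.

Lemma covarianceE x y : b x y = mean (fun z => hdot z x * hdot z y).
Proof.
by apply: EFin_inj; rewrite [LHS]K_cov (expectation_mean (quadratic_growth_dot x y)).
Qed.

Lemma covariance_psd : psd_form b.
Proof.
split=> [a x y z|x y|x]; rewrite !covarianceE.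
- have qd u v := quadratic_growth_dot u v.
  rewrite -meanZ // -meanD //; last exact: quadratic_growthZ.
  by congr mean; apply/funext => u; rewrite hdotDr hdotZr; ring.
- by congr mean; apply/funext => u; rewrite mulrC.
- by apply: Rintegral_ge0 => w _; rewrite -expr2 sqr_ge0.
Qed.

Lemma mean_sum_dot (I : finType) (f : I -> H) :
  mean (fun x => \sum_i hdot x (f i) ^+ 2) = \sum_i b (f i) (f i).
Proof.
rewrite mean_sum => [|i].
  by apply: eq_bigr => i _; rewrite covarianceE.
by under eq_fun do rewrite expr2; exact: quadratic_growth_dot.
Qed.

(** Dominated convergence along any exhausting sequence of finite families, not
    only the initial segments of one sequence: for tensor products the families
    are indexed by boxes of multi-indices. *)
Lemma covariance_trace_cvg (I : nat -> finType) (f : forall N, I N -> H) :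
  (forall N, orthonormal0 (f N)) ->
  (forall x, (fun N => \sum_i hdot x (f N i) ^+ 2) @ \oo --> `|x| ^+ 2) ->
  (fun N => \sum_i b (f N i) (f N i)) @ \oo --> second_moment.
Proof.
move=> fO fC.
have sE N : \sum_i b (f N i) (f N i) = mean (fun x => \sum_i hdot x (f N i) ^+ 2).
  by rewrite mean_sum_dot.
under eq_fun do rewrite sE.
apply: fine_cvg.
rewrite /second_moment -(expectation_mean quadratic_growth_norm) expectation.unlock.
have sum0 N x : 0 <= \sum_i hdot x (f N i) ^+ 2.
  by apply: sumr_ge0 => i _; exact: sqr_ge0.
apply: (dominated_cvg measurableT (g := EFin \o (fun w => `|X w| ^+ 2))).
- move=> N; apply/measurable_EFinP.
  exact: (continuous_measurable (proj1 (quadratic_growth_sum_dot (f N)))).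
- by move=> w _; apply: cvg_EFin; [near=> N|exact: fC].
- by [].
- exact: norm2_integrable.
- by move=> N w _ /=; rewrite lee_fin ger0_norm // bessel.
Unshelve. all: by end_near. Qed.

Lemma covariance_has_trace : has_trace b second_moment.
Proof.
split=> [I f fO|e eO eC].
  rewrite -mean_sum_dot; apply: le_mean;
    [exact: quadratic_growth_sum_dot|exact: quadratic_growth_norm|].
  exact: bessel.
apply: (covariance_trace_cvg (f := fun N (i : 'I_N) => e i)) => // N.
exact: orthonormal0_comp val_inj eO.
Qed.

Lemma mean_residual (I : finType) (f : I -> H) : orthonormal0 f ->
  mean (fun x => `|x - \sum_i hdot x (f i) *: f i| ^+ 2) =
  second_moment - \sum_i b (f i) (f i).
Proof.
move=> fO.
have -> : (fun x => `|x - \sum_i hdot x (f i) *: f i| ^+ 2) =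
    (fun x => `|x| ^+ 2 + (-1) * \sum_i hdot x (f i) ^+ 2).
  by apply/funext => x; rewrite mulN1r (oproj_dist fO).
rewrite meanD;
  [|exact: quadratic_growth_norm|exact/quadratic_growthZ/quadratic_growth_sum_dot].
by rewrite meanZ ?mean_sum_dot ?mulN1r //; exact: quadratic_growth_sum_dot.
Qed.

Lemma rank_residual_growth n (l : 'I_n -> {scalar H}) (psi : 'I_n -> H) :
  (forall m, continuous (l m : H -> R)) ->
  quadratic_growth (fun x => `|x - \sum_(m < n) l m x *: psi m| ^+ 2).
Proof.
move=> lc.
have [Ac [C AC]] : continuous (fun x : H => \sum_(m < n) l m x *: psi m) /\
    exists C, forall x : H, `|\sum_(m < n) l m x *: psi m| <= C * `|x|.
  pose r := index_enum 'I_n; rewrite -/r; elim: r => [|m r [Ac [C AC]]].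
    under eq_fun do rewrite big_nil; split; first by move=> x; exact: cvg_cst.
    by exists 0 => x; rewrite big_nil normr0 mul0r.
  under eq_fun do rewrite big_cons; split.
    move=> x; apply: cvgD; last exact: Ac.
    by apply: cvgZr_tmp; exact: lc.
  have [D [_ hD]] := (linear_boundedP (l m)).1
    ((linear_bounded_continuous (l m)).2 (lc m)).
  exists ((D + 1) * `|psi m| + C) => x; rewrite big_cons.
  apply: le_trans (ler_normD _ _) _; rewrite mulrDl; apply: lerD => //.
  by rewrite normrZ mulrAC ler_wpM2r // hD // ltrDl.
split.
  move=> x; under eq_fun do rewrite expr2.
  by apply: cvgM; apply: cvg_norm; apply: cvgB; [exact: cvg_id|exact: Ac|
    exact: cvg_id|exact: Ac].
exists ((1 + C) ^+ 2) => x; rewrite ger0_norm ?exprn_ge0 // -exprMn.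
have xA : `|x - \sum_(m < n) l m x *: psi m| <= (1 + C) * `|x|.
  by rewrite mulrDl mul1r; apply: le_trans (ler_normB _ _) _; rewrite lerD2l.
by rewrite ler_pXn2r ?nnegrE //; exact: le_trans xA.
Qed.

Lemma approx_error_le n (I : finType) (f : I -> H) :
  orthonormal0 f -> (#|I| <= n)%N ->
  approx_error X n <= Num.sqrt (second_moment - \sum_i b (f i) (f i)).
Proof.
move=> fO In; pose g (i : 'I_n) := nth 0 (codom f) i.
have gf (i : 'I_n) : g i = 0 \/ exists2 k : 'I_#|I|, val k = i & g i = f (enum_val k).
  have [iI|iI] := ltnP i #|I|; [right|left].
    by exists (Ordinal iI) => //; rewrite /g (nth_codom 0 f (Ordinal iI)).
  by rewrite /g nth_default // size_codom.
have gO : orthonormal0 g.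
  split=> [i j ij|i].
    have [->|[k ki ->]] := gf i; first by rewrite hdot0l.
    have [->|[k' kj ->]] := gf j; first by rewrite hdot0r.
    apply: fO.1; apply: contra ij => /eqP/enum_val_inj kk.
    by apply/eqP/val_inj; rewrite /= -ki kk.
  by have [|[k _ ->]] := gf i; [left|exact: fO.2].
have -> : \sum_i b (f i) (f i) = \sum_(i < n) b (g i) (g i).
  have b0 : b 0 0 = 0 by exact: psd0l covariance_psd _.
  rewrite -(big_mkord xpredT (fun i => b (nth 0 (codom f) i) (nth 0 (codom f) i))).
  rewrite (big_cat_nat (n := size (codom f))) ?size_codom //=.
  rewrite [X in _ + X]big_nat_cond [X in _ + X]big1 ?addr0; last first.
    move=> i /andP[/andP[Ii _] _]; rewrite nth_default ?size_codom //.
  rewrite -(size_codom f) -(big_nth 0 xpredT (fun x => b x x)).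
  by rewrite big_map big_enum.
apply: ge_inf.
  by exists 0 => _ [l [psi [_ ->]]]; exact: sqrtr_ge0.
exists (fun m => hdot (g m) : {scalar H}), g; split.
  by move=> m; exact: hdot_continuous.
rewrite -mean_residual // expectation.unlock /mean /Rintegral; congr Num.sqrt; congr fine.
apply: eq_integral => w _; congr (EFin (`|_ - _| ^+ 2)).
by apply: eq_bigr => i _; rewrite hdotC.
Qed.

(** The vectors [psi] of an admissible approximation are combinations of an
    orthonormal family of the same length, and projecting on that family
    does not increase the error. *)
Lemma approx_error_ge n (c : R) :
  (forall g : 'I_n -> H, orthonormal0 g -> \sum_i b (g i) (g i) <= c) ->
  Num.sqrt (second_moment - c) <= approx_error X n.
Proof.
move=> hc; apply: lb_le_inf.
  exists (Num.sqrt (fine 'E_(re_prob X)[fun w =>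
     (`|X w - \sum_(m < n) (\0 : {scalar H}) (X w) *: 0| ^+ 2)%R]%E)).
  exists (fun=> \0 : {scalar H}), (fun=> 0); split=> // m x; exact: cvg_cst.
move=> _ [l [psi [lc ->]]]; rewrite ler_wsqrtr //.
pose v m : H := if insub m is Some i then psi i else 0.
have [e eO ev] := gram_schmidt v.
have [C hC] : exists C : nat -> nat -> R, forall m : 'I_n,
    psi m = \sum_(k < n) C m k *: e k.
  have [C hC] := choice ev; exists C => m.
  by rewrite -hC // /v valK.
have eO' : orthonormal0 (e \o val : 'I_n -> H).
  exact: orthonormal0_comp val_inj eO.
rewrite (expectation_mean (rank_residual_growth psi lc)) /=.
apply: (@le_trans _ _ (mean (fun x => `|x - \sum_(k < n) hdot x (e k) *: e k| ^+ 2))).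
  by rewrite (mean_residual eO') lerD2l lerN2; exact: hc.
apply: le_mean.
- pose l' (m : 'I_n) : {scalar H} := hdot (e m) : {scalar H}.
  have -> : (fun x : H => `|x - \sum_(k < n) hdot x (e k) *: e k| ^+ 2) =
      (fun x : H => `|x - \sum_(k < n) l' k x *: e k| ^+ 2).
    apply/funext => x; congr (`|_ - _| ^+ 2).
    by apply: eq_bigr => k _; rewrite hdotC.
  by apply: rank_residual_growth => m; exact: hdot_continuous.
- exact: rank_residual_growth.
move=> x; rewrite (oproj_dist eO').
have -> : \sum_(m < n) l m x *: psi m =
    \sum_(k < n) (\sum_(m < n) l m x * C m k) *: e k.
  under eq_bigr do rewrite hC scaler_sumr.
  rewrite exchange_big; apply: eq_bigr => k _; rewrite scaler_suml.
  by apply: eq_bigr => m _; rewrite scalerA.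
exact: (oproj_best eO').
Qed.

End Covariance.
End Moments.

(** * Tensor products *)

Lemma cvg_prod_fin {R : realType} (I : finType) (F : I -> nat -> R) (l : I -> R) :
  (forall i, F i @ \oo --> l i) ->
  (fun N => \prod_i F i N) @ \oo --> \prod_i l i.
Proof. by move=> Fl; apply: cvg_big => [|i _]; [exact: mul_continuous|]. Qed.

Section KyFan.
Context {R : realType} {H : sepHilbertType R}.
Variables (b : H -> H -> R) (tau : R).
Hypotheses (b_psd : psd_form b) (b_tr : has_trace b tau).

(** Rank [n] captures at most the sum of the [n] largest eigenvalues, in a form
    that avoids sorting: with a threshold [theta], each eigenvalue splits into its
    excess over [theta], whose total weight is at most one per eigenvector, and a
    part at most [theta], whose total weight is at most one per [g i]. The last
    summand accounts for the trace not captured by [w]. *)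
Lemma ky_fan (J : finType) (w : J -> H) (L : J -> R) n (g : 'I_n -> H) theta :
  orthonormal0 w -> (forall k y, b (w k) y = L k * hdot (w k) y) ->
  orthonormal0 g -> 0 <= theta ->
  \sum_i b (g i) (g i) <= \sum_k Num.max (L k - theta) 0 + n%:R * theta +
    n%:R * (tau - \sum_k b (w k) (w k)).
Proof.
move=> wO bw gO t0; set r := tau - _.
have r0 : 0 <= r by rewrite subr_ge0; exact: b_tr.1.
have bg i : b (g i) (g i) <= \sum_k Num.max (L k - theta) 0 * hdot (g i) (w k) ^+ 2
    + theta + r.
  have := psd_residual b_psd wO bw (g i); set y := _ - _ => yE.
  have yw k : hdot y (w k) = 0 by rewrite hdotBl (hdot_oproj wO) subrr.
  have := has_trace_orthogonal b_psd b_tr wO yw; rewrite -/r yE => hy.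
  have g1 : `|g i| ^+ 2 <= 1 by rewrite hilbert_normE (orthonormal0_norm_le1 gO).
  have y1 : `|y| ^+ 2 <= 1.
    rewrite (oproj_dist wO) (le_trans _ g1) // gerBl.
    by apply: sumr_ge0 => k _; exact: sqr_ge0.
  have hr : r * `|y| ^+ 2 <= r by rewrite ler_piMr.
  have ht : \sum_k L k * hdot (g i) (w k) ^+ 2 <=
      \sum_k Num.max (L k - theta) 0 * hdot (g i) (w k) ^+ 2 + theta.
    apply: (@le_trans _ _ (\sum_k Num.max (L k - theta) 0 * hdot (g i) (w k) ^+ 2 +
      theta * \sum_k hdot (g i) (w k) ^+ 2)).
      rewrite mulr_sumr -big_split; apply: ler_sum => k _ /=.
      by rewrite -mulrDl ler_wpM2r ?sqr_ge0 // -lerBlDr le_max lexx.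
    by rewrite lerD2l ler_piMr // (le_trans (bessel wO _)).
  lra.
clearbody r; apply: le_trans (ler_sum _ (fun i _ => bg i)) _.
rewrite !big_split /= exchange_big /= !sumr_const !card_ord !mulr_natl !lerD2r.
apply: ler_sum => k _; rewrite -mulr_sumr ler_piMr ?le_max ?lexx ?orbT //.
under eq_bigr do rewrite hdotC.
by rewrite (le_trans (bessel gO _)) // hilbert_normE (orthonormal0_norm_le1 wO).
Qed.

End KyFan.

Section EigenvalueSeries.
Context {R : realType} {H : sepHilbertType R}.

Lemma eigenvalue_series_cvg (X : random_element H) (K : H -> H) (lam : nat -> R) :
  covariance_operator X K -> eigenvalue_sequence K lam ->
  series lam @ \oo --> second_moment X.
Proof.
move=> K_cov K_lam.
have b_psd := covariance_psd K_cov; have b_tr := covariance_has_trace K_cov.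
have [u [uO Ku u1]] := eigensystem_exists b_psd K_lam.
exact: (eigen_series_cvg b_psd b_tr K_lam uO Ku u1).
Qed.

End EigenvalueSeries.

Section Tensor.
Context {R : realType} {I : finType} {H : I -> sepHilbertType R}
  {HT : sepHilbertType R} {T : (forall i, H i) -> HT}.
Hypothesis hT : hilbert_tensor_product T.

(** Multilinearity of the elementary tensors follows from the product formula
    for inner products: the difference has norm zero. *)
Lemma tensor_scale (c : I -> R) (x : forall i, H i) :
  T (fun i => c i *: x i) = (\prod_i c i) *: T x.
Proof.
apply/eqP; rewrite -subr_eq0 -hdot_eq0 hdotBl !hdotBr !hdotZl !hdotZr !hT.1.
have -> : \prod_i hdot (c i *: x i) (c i *: x i) =
    (\prod_i c i) * (\prod_i c i) * \prod_i hdot (x i) (x i).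
  by rewrite -!big_split; apply: eq_bigr => i _; rewrite hdotZl hdotZr /=; ring.
have -> : \prod_i hdot (c i *: x i) (x i) = (\prod_i c i) * \prod_i hdot (x i) (x i).
  by rewrite -!big_split; apply: eq_bigr => i _; rewrite hdotZl.
have -> : \prod_i hdot (x i) (c i *: x i) = (\prod_i c i) * \prod_i hdot (x i) (x i).
  by rewrite -!big_split; apply: eq_bigr => i _; rewrite hdotZr.
by apply/eqP; ring.
Qed.

Definition tensor_family (u : forall i, nat -> H i) N (k : {ffun I -> 'I_N}) : HT :=
  T (fun i => u i (k i)).

Lemma tensor_family_norm u N (k : {ffun I -> 'I_N}) :
  hdot (tensor_family u k) (tensor_family u k) =
  \prod_i hdot (u i (k i)) (u i (k i)).
Proof. by rewrite hT.1. Qed.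

Lemma tensor_orthonormal u N : (forall i, orthonormal0 (u i)) ->
  orthonormal0 (@tensor_family u N).
Proof.
move=> uO; split=> [k l|k].
  move=> kl; have [i ki] : exists i, k i != l i.
    apply/existsP; rewrite -negb_forall; apply: contra kl => /forallP kl.
    by apply/eqP/ffunP => i; exact/eqP.
  by rewrite hT.1 (bigD1 i) //= (uO i).1 ?mul0r.
have [k1|] := boolP [forall i, hdot (u i (k i)) (u i (k i)) == 1].
  by right; rewrite tensor_family_norm big1 // => i _; apply/eqP/(forallP k1).
rewrite negb_forall => /existsP[i ki]; left.
apply/eqP; rewrite -hdot_eq0 tensor_family_norm (bigD1 i) //=.
by case: ((uO i).2 (k i)) ki => ->; rewrite ?eqxx // hdot0l mul0r eqxx.
Qed.

(** On elementary tensors, Parseval's identity is the product of the identities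
    of the factors. The vectors for which the projection residual tends to zero
    form a closed subspace, so density of the span gives the general case. *)
Lemma tensor_complete e : (forall i, orthonormal0 (e i)) ->
  (forall i, complete_system (e i)) -> forall v : HT,
  (fun N => \sum_k hdot v (@tensor_family e N k) ^+ 2) @ \oo --> `|v| ^+ 2.
Proof.
move=> eO eC.
have teO N := @tensor_orthonormal e N eO.
pose r N v := v - oproj (@tensor_family e N) v.
have rD N v w a : r N (a *: v + w) = a *: r N v + r N w.
  rewrite /r /oproj scalerBr addrACA -opprD scaler_sumr -big_split; congr (_ - _).
  by apply: eq_bigr => k _ /=; rewrite hdotDl hdotZl scalerDl scalerA.
have rE N v : `|r N v| ^+ 2 = `|v| ^+ 2 - \sum_k hdot v (@tensor_family e N k) ^+ 2.
  exact: (oproj_dist (teO N)).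
have r_le N v : `|r N v| <= `|v|.
  rewrite -(@ler_pXn2r _ 2) ?nnegrE // rE gerBl.
  by apply: sumr_ge0 => k _; exact: sqr_ge0.
have rT x : (fun N => `|r N (T x)|) @ \oo --> (0 : R).
  have : (fun N => `|r N (T x)| ^+ 2) @ \oo --> (0 : R).
    under eq_fun do rewrite rE.
    suff : (fun N => `|T x| ^+ 2 - \sum_k hdot (T x) (@tensor_family e N k) ^+ 2)
      @ \oo --> `|T x| ^+ 2 - `|T x| ^+ 2 by rewrite subrr.
    apply: cvgB; first exact: cvg_cst.
    have -> : `|T x| ^+ 2 = \prod_i `|x i| ^+ 2.
      by rewrite hilbert_normE hT.1; apply: eq_bigr => i _; rewrite hilbert_normE.
    have sE N : \sum_k hdot (T x) (@tensor_family e N k) ^+ 2 =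
        \prod_i \sum_(j < N) hdot (x i) (e i j) ^+ 2.
      rewrite bigA_distr_bigA; apply: eq_bigr => k _.
      by rewrite hT.1 -prodrXl.
     under eq_fun do rewrite sE.
    by apply: cvg_prod_fin => i; exact: eC.
  move=> h; rewrite -sqrtr0; under eq_fun do rewrite -[`|_|]ger0_norm // -sqrtr_sqr.
  exact: (cvg_comp _ _ h (@sqrt_continuous R 0)).
move=> v; have rv : (fun N => `|r N v|) @ \oo --> (0 : R).
  apply/cvgr0Pnorm_lt => eps eps0; have eps20 : 0 < eps / 2 by rewrite divr_gt0.
  have [_ [] /[swap] -[n [a [x ->]]]] := hT.2 _
    (ex_intro _ v (ballxx v eps20)) (ball_open v (eps / 2)).
  set w := \sum_m _ => vw; have {}vw : ball v (eps / 2) w := vw.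
  rewrite -ball_normE /= in vw.
  have rw : (fun N => `|r N w|) @ \oo --> (0 : R).
    have r0 N : r N 0 = 0.
      by apply/eqP; rewrite -normr_le0; apply: le_trans (r_le N 0) _; rewrite normr0.
    rewrite /w; elim/big_rec: _ => [|m z _ IH].
      by under eq_fun do rewrite r0 normr0; exact: cvg_cst.
    apply: (@squeeze_cvgr _ _ _ _ (fun=> 0)
      (fun N => `|a m| * `|r N (T (x m))| + `|r N z|)).
    - near=> N; rewrite normr_ge0 /= rD; apply: le_trans (ler_normD _ _) _.
      by rewrite normrZ.
    - exact: cvg_cst.
    - suff : (fun N => `|a m| * `|r N (T (x m))| + `|r N z|) @ \oo -->
        `|a m| * 0 + 0 by rewrite mulr0 addr0.
      by apply: cvgD => //; apply: cvgM; [exact: cvg_cst|exact: rT].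
  have /cvgr0Pnorm_lt/(_ _ eps20) := rw; apply: filterS => N /=.
  rewrite !normr_id => rNw.
  have -> : r N v = 1 *: r N (v - w) + r N w by rewrite -rD scale1r subrK.
  rewrite scale1r; apply: le_lt_trans (ler_normD _ _) _.
  by have := r_le N (v - w); lra.
have -> : (fun N => \sum_k hdot v (@tensor_family e N k) ^+ 2) =
    (fun N => `|v| ^+ 2 - `|r N v| * `|r N v|).
  by apply/funext => N; rewrite -expr2 rE; ring.
suff : (fun N => `|v| ^+ 2 - `|r N v| * `|r N v|) @ \oo -->
  `|v| ^+ 2 - 0 * 0 by rewrite mulr0 subr0.
by apply: cvgB; [exact: cvg_cst|exact: cvgM].
Unshelve. all: by end_near. Qed.

Section Factors.
Context {X1 : forall i, random_element (H i)} {K1 : forall i, H i -> H i}.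
Context {lam : I -> nat -> R} {X : random_element HT} {K : HT -> HT}.
Hypothesis hK1 : forall i, covariance_operator (X1 i) (@K1 i).
Hypothesis hlam : forall i, eigenvalue_sequence (@K1 i) (lam i).
Hypothesis hK : covariance_operator X K.
Hypothesis hKT : forall x, K (T x) = T (fun i => @K1 i (x i)).

Let b1_psd i := @covariance_psd R (H i) (X1 i) (@K1 i) (@hK1 i).
Let b1_tr i := @covariance_has_trace R (H i) (X1 i) (@K1 i) (@hK1 i).
Let b_psd := covariance_psd hK.
Let b_tr := covariance_has_trace hK.

Lemma covariance_tensor x y :
  hdot (K (T x)) (T y) = \prod_i hdot (@K1 i (x i)) (y i).
Proof. by rewrite hKT hT.1. Qed.

(** Compute the trace on the product of complete systems of the factors, over
    larger and larger boxes of multi-indices. *)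
Lemma tensor_second_moment : second_moment X = \prod_i second_moment (X1 i).
Proof.
have ex i := cid2 (@complete_system_exists R (H i)).
pose e i := s2val (ex i).
have eO i : orthonormal0 (e i) := s2valP (ex i).
have eC i : complete_system (e i) := s2valP' (ex i).
have c1 := covariance_trace_cvg hK (fun N => @tensor_orthonormal e N eO)
  (tensor_complete eO eC).
have c2 : (fun N => \sum_k hdot (K (@tensor_family e N k)) (tensor_family e k)) @ \oo -->
    \prod_i second_moment (X1 i).
  have sE N : \sum_k hdot (K (@tensor_family e N k)) (tensor_family e k) =
      \prod_i \sum_(j < N) hdot (@K1 i (e i j)) (e i j).
    by rewrite bigA_distr_bigA; apply: eq_bigr => k _; exact: covariance_tensor.
  under eq_fun do rewrite sE.
  by apply: cvg_prod_fin => i; exact: (b1_tr i).2.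
exact: (cvg_unique _ c1 c2).
Qed.

(** The family consists of the elementary tensors of eigenvectors of the factors;
    their eigenvalues multiply by [tensor_scale]. *)
Lemma tensor_eigenfamily : exists w : forall N, {ffun I -> 'I_N} -> HT,
  forall N, [/\ orthonormal0 (w N),
    forall k y, hdot (K (w N k)) y = (\prod_i lam i (k i)) * hdot (w N k) y &
    forall k, hdot (K (w N k)) (w N k) = \prod_i lam i (k i)].
Proof.
have ex i := cid (eigensystem_exists (b1_psd i) (hlam i)).
pose u i := sval (ex i).
have uP i : [/\ orthonormal0 (u i), forall k, @K1 i (u i k) = lam i k *: u i k &
    forall k, hdot (u i k) (u i k) = (lam i k != 0)%:R] := svalP (ex i).
exists (@tensor_family u) => N; split=> [|k y|k].
- by apply: tensor_orthonormal => i; have [] := uP i.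
- rewrite hKT.
  have -> : (fun i => @K1 i (u i (k i))) = (fun i => lam i (k i) *: u i (k i)).
    by apply: functional_extensionality_dep => i; have [_ -> _] := uP i.
  by rewrite tensor_scale hdotZl.
- rewrite covariance_tensor; apply: eq_bigr => i _.
  have [_ -> ui] := uP i; rewrite hdotZl ui.
  by case: eqVneq => [->|_]; rewrite ?mul0r ?mulr1.
Qed.

(** The approximation is the projection on the eigenvectors indexed by [A], whose
    error is the part of the trace that they leave. *)
Lemma tensor_error_le n N (A : {set {ffun I -> 'I_N}}) (eps : R) :
  0 <= eps -> (#|A| <= n)%N ->
  (1 - eps ^+ 2) * \prod_i second_moment (X1 i) <= \sum_(k in A) \prod_i lam i (k i) ->
  approx_error X n <= eps * initial_error X.
Proof.
move=> eps0 An hA; have [w /(_ N)[wO _ ww]] := tensor_eigenfamily.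
have fO : orthonormal0 (fun i : 'I_#|A| => w N (enum_val i)).
  by apply: orthonormal0_comp wO; exact: enum_val_inj.
apply: le_trans (approx_error_le hK fO _) _; first by rewrite card_ord.
rewrite initial_errorE -[X in X * _]ger0_norm // -sqrtr_sqr -sqrtrM ?sqr_ge0 //.
rewrite ler_wsqrtr // tensor_second_moment.
under [X in _ - X]eq_bigr do rewrite ww.
rewrite -(big_enum_val (fun k : {ffun I -> 'I_N} => \prod_i lam i (k i))) /=.
lra.
Qed.

(** The lower bound on the error without sorting the products. The eigenvectors in
    a box capture the whole trace in the limit, which removes the error term of
    the Ky Fan bound; the left-hand side grows with the box. *)
Lemma tensor_error_ge n N (eps theta : R) : 0 <= eps -> 0 <= theta ->
  approx_error X n <= eps * initial_error X ->
  \sum_(k : {ffun I -> 'I_N}) Num.min (\prod_i lam i (k i)) theta <=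
  eps ^+ 2 * \prod_i second_moment (X1 i) + n%:R * theta.
Proof.
move=> eps0 t0 err; set L := \prod_i second_moment _.
have [w wP] := tensor_eigenfamily.
have L0 : 0 <= L.
  rewrite /L -tensor_second_moment; apply: Rintegral_ge0 => x _.
  exact: exprn_ge0.
have pl0 M (k : {ffun I -> 'I_M}) : 0 <= \prod_i lam i (k i).
  by apply: prodr_ge0 => i _; exact: eigenvalue_ge0 (b1_psd i) (hlam i) _.
pose S M := \sum_(k : {ffun I -> 'I_M}) \prod_i lam i (k i).
have S_cvg : S @ \oo --> L.
  have sE M : S M = \prod_i \sum_(j < M) lam i j by rewrite bigA_distr_bigA.
  rewrite (funext sE); apply: cvg_prod_fin => i.
  have -> : (fun M => \sum_(j < M) lam i j) = series (lam i).
    by apply/funext => M; rewrite /series /= big_mkord.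
  exact: eigenvalue_series_cvg (@hK1 i) (hlam i).
have minE (x : R) : Num.min x theta = x - Num.max (x - theta) 0.
  by case: (leP x theta) => xt; case: (leP (x - theta) 0) => xt'; lra.
have key M : \sum_(k : {ffun I -> 'I_M}) Num.min (\prod_i lam i (k i)) theta <=
    eps ^+ 2 * L + n%:R * theta + n%:R * (L - S M).
  have [wO bw ww] := wP M.
  have SE : \sum_k hdot (K (w M k)) (w M k) = S M.
    by apply: eq_bigr => k _; rewrite ww.
  have SL : S M <= L by rewrite -SE /L -tensor_second_moment; exact: b_tr.1.
  have /le_trans/(_ err) := approx_error_ge hK
    (fun (g : 'I_n -> HT) gO => ky_fan b_psd b_tr wO bw gO t0).
  rewrite SE initial_errorE tensor_second_moment -/L.
  set c := \sum_k Num.max _ _ + _ + _ => hc.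
  have {}hc : L - c <= eps ^+ 2 * L.
    have [c0|c0] := leP (L - c) 0.
      by apply: le_trans c0 _; rewrite mulr_ge0 ?sqr_ge0.
    move: hc; rewrite -(@ler_pXn2r _ 2) ?nnegrE ?mulr_ge0 ?sqrtr_ge0 //.
    by rewrite exprMn !sqr_sqrtr // ltW.
  under eq_bigr do rewrite minE.
  rewrite big_split /= sumrN -/(S M); rewrite /c in hc; lra.
have mono M : (N <= M)%N ->
    \sum_(k : {ffun I -> 'I_N}) Num.min (\prod_i lam i (k i)) theta <=
    \sum_(k : {ffun I -> 'I_M}) Num.min (\prod_i lam i (k i)) theta.
  move=> NM.
  pose h (k : {ffun I -> 'I_N}) : {ffun I -> 'I_M} := [ffun i => widen_ord NM (k i)].
  have h_inj : injective h.
    move=> k l /ffunP kl; apply/ffunP => i; have := kl i; rewrite !ffunE.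
    by move=> /(congr1 val) /= /val_inj.
  pose G (k : {ffun I -> 'I_M}) := Num.min (\prod_i lam i (k i)) theta.
  have GE (k : {ffun I -> 'I_N}) : Num.min (\prod_i lam i (k i)) theta = G (h k).
    by congr Num.min; apply: eq_bigr => i _; rewrite ffunE.
  rewrite (eq_bigr _ (fun k _ => GE k)).
  rewrite (eq_bigl (fun k => k \in [set: {ffun I -> 'I_N}]%SET)); last first.
    by move=> k; rewrite finset.in_setT.
  rewrite -(big_imset (h := h) G (A := [set: {ffun I -> 'I_N}]%SET)) /=; last first.
    by move=> ? ? _ _; exact: h_inj.
  rewrite big_mkcond; apply: ler_sum => k _; case: ifP => // _.
  by rewrite le_min pl0.
apply/ler_addgt0Pr => d d0.
have d'0 : 0 < d / n.+1%:R by rewrite divr_gt0.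
have /cvgrPdist_lt/(_ _ d'0) [M0 _ hM] := S_cvg.
have := hM (maxn M0 N) (leq_maxl _ _) => /= /(le_lt_trans (ler_norm _)) hS.
apply: le_trans (mono _ (leq_maxr M0 N)) _; apply: le_trans (key _) _.
rewrite lerD2l; apply: (@le_trans _ _ (n%:R * (d / n.+1%:R))).
  by rewrite ler_wpM2l // ltW.
rewrite mulrCA ler_piMr ?(ltW d0) // ler_pdivrMr // mul1r.
by rewrite ler_nat.
Qed.

End Factors.
End Tensor.

(** * Elementary estimates *)

Section Excess.
Context {R : realType}.
Implicit Types p u t x : R.

(** The weight [p `^ (1 - u)] is [p] tilted by the exponential of [u] times the
    information [- ln p]. *)
Lemma powR1B p u : 0 < p -> p `^ (1 - u) = p * expR (u * - ln p).
Proof.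
move=> p0; rewrite /powR gt_eqF // mulrBl mul1r expRD lnK ?posrE //.
by rewrite mulrN.
Qed.

Lemma powR1B_0 u : u < 1 -> 0 `^ (1 - u) = 0 :> R.
Proof. by move=> u1; rewrite powR0 // subr_eq0 gt_eqF. Qed.

Lemma expR_sub1_le x : expR x - 1 <= x * expR x.
Proof.
have := expR_ge1Dx (- x); rewrite expRN => h.
have e0 := expR_gt0 x.
have : (1 - x) * expR x <= 1 by rewrite -ler_pdivlMr ?div1r.
lra.
Qed.

Lemma powR_excess_ge_log p u : 0 <= p -> p <= 1 -> u < 1 ->
  u * (p * `|ln p|) <= p `^ (1 - u) - p.
Proof.
rewrite le_eqVlt => /predU1P[<-|p0] p1 u1.
  by rewrite powR1B_0 // mul0r mulr0 subr0.
rewrite powR1B // ler0_norm ?ln_le0 //.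
have := expR_ge1Dx (u * - ln p); rewrite -(ler_pM2l p0); lra.
Qed.

(** Below the threshold the tilted weight exceeds [p] by a fixed factor, so the
    excess controls the tilted weight itself. *)
Lemma powR_excess_ge_tail p u t : 0 <= p -> 0 < u < 1 -> p < expR (- t) ->
  p `^ (1 - u) * (1 - expR (- (u * t))) <= p `^ (1 - u) - p.
Proof.
rewrite le_eqVlt => /predU1P[<-|p0] /andP[u0 u1] pt.
  by rewrite powR1B_0 // mul0r subr0.
rewrite mulrBr mulr1 lerD2l lerN2 powR1B // -mulrA -expRD.
rewrite ler_peMr ?(ltW p0) //; apply: le_trans (expR_ge1Dx _); rewrite lerDl.
have : ln p <= - t by rewrite -(expRK (- t)) ler_ln ?posrE ?expR_gt0 // ltW.
rewrite -(ler_pM2l u0); lra.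
Qed.

(** Above the threshold the tilting factor is at most [expR (u * t)], so
    [expR_sub1_le] linearizes the excess. *)
Lemma powR_excess_le_head p u t : p <= 1 -> 0 < u < 1 -> expR (- t) <= p ->
  p `^ (1 - u) - p <= u * expR (u * t) * (p * `|ln p|).
Proof.
move=> p1 /andP[u0 u1] pt; have p0 : 0 < p by apply: lt_le_trans pt; exact: expR_gt0.
rewrite powR1B // ler0_norm ?ln_le0 //; set z := - ln p.
have z0 : 0 <= z by rewrite oppr_ge0 ln_le0.
have zt : z <= t.
  by rewrite lerNl -(expRK (- t)) ler_ln ?posrE ?expR_gt0.
have h1 := expR_sub1_le (u * z).
have h2 : expR (u * z) <= expR (u * t) by rewrite ler_expR ler_pM2l.
have h3 : u * z * expR (u * z) <= u * z * expR (u * t).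
  by rewrite ler_wpM2l // mulr_ge0 // ltW.
have : p * (expR (u * z) - 1) <= p * (u * z * expR (u * t)).
  by rewrite ler_pM2l //; exact: le_trans h3.
lra.
Qed.

(** Bernoulli's inequality, obtained from Young's inequality with exponents
    [(1 - u)^-1] and [u^-1]. *)
Lemma powR_excess_le_bernoulli p u : 0 <= p -> 0 < u < 1 ->
  p `^ (1 - u) - p <= u * (1 - p).
Proof.
move=> p0 /andP[u0 u1]; have v0 : 0 < 1 - u by rewrite subr_gt0.
have := @conjugate_powR R (p `^ (1 - u)) 1 (1 - u)^-1 u^-1.
rewrite powR_ge0 ler01 !invr_gt0 v0 u0 !invrK subrK => /(_ erefl erefl erefl erefl erefl).
rewrite -powRrM divff ?gt_eqF // powRr1 // powR1; lra.
Qed.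

Lemma powR_excess_ge0 p u : 0 <= p -> p <= 1 -> 0 <= u < 1 -> 0 <= p `^ (1 - u) - p.
Proof.
move=> p0 p1 /andP[u0 u1]; apply: le_trans (powR_excess_ge_log p0 p1 u1).
by rewrite !mulr_ge0.
Qed.

Lemma lnp_ge1 x : 1 <= lnp x.
Proof. by rewrite /lnp le_max lexx. Qed.

Lemma lnp_le x : 1 <= x -> lnp x <= 1 + ln x.
Proof.
move=> /ln_ge0 h; rewrite /lnp ge_max; apply/andP; split; lra.
Qed.

Lemma lnp_ge x : 1 + ln x <= 2 * lnp x.
Proof. by rewrite /lnp; case: (leP 1 (ln x)) => h; lra. Qed.

Lemma sum_le_prod1D n (a : nat -> R) : (forall j, 0 <= a j) ->
  1 + \sum_(j < n) a j <= \prod_(j < n) (1 + a j).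
Proof.
move=> a0; elim: n => [|n IH]; first by rewrite !big_ord0 addr0.
rewrite !big_ord_recr /=.
have : 0 <= \sum_(j < n) a j by apply: sumr_ge0 => j _.
have := a0 n; nra.
Qed.

Lemma prod1D_le_expR n (a : nat -> R) : (forall j, 0 <= a j) ->
  \prod_(j < n) (1 + a j) <= expR (\sum_(j < n) a j).
Proof.
move=> a0; elim: n => [|n IH]; first by rewrite !big_ord0 expR0.
rewrite !big_ord_recr /= expRD ler_pM ?expR_ge1Dx ?addr_ge0 //.
by apply: prodr_ge0 => j _; rewrite addr_ge0.
Qed.

(** Reduces the extended-real sums of the two conditions to finite sums. *)
Lemma nnesum_le_iff d (f : nat -> nat -> R) (c : R) : (forall j k, 0 <= f j k) ->
  (\sum_(j < d) \sum_(1 <= k <oo) (f j k)%:E <= c%:E)%E <->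
  forall N, \sum_(j < d) \sum_(1 <= k < N) f j k <= c.
Proof.
move=> f0; split=> [h N|h].
  rewrite -lee_fin -sumEFin; apply: le_trans h; apply: lee_sum => j _.
  rewrite -sumEFin; apply: nneseries_lim_ge => k _ _.
  by rewrite lee_fin.
rewrite -nneseries_sum; last by move=> *; rewrite lee_fin.
apply: lime_le.
  apply: is_cvg_nneseries => k _ _; apply: sume_ge0 => j _.
  by rewrite lee_fin.
near=> N; rewrite exchange_big /=.
under eq_bigr do rewrite sumEFin.
by rewrite sumEFin lee_fin.
Unshelve. all: by end_near. Qed.

End Excess.

(** * The two conditions and products of power sums *)

Section Conditions.
Context {R : realType}.
Variable mu : nat -> nat -> R.
Hypothesis mu_ge0 : forall j k, 0 <= mu j k.
Hypothesis mu_le_head : forall j k, mu j k <= mu j 0%N.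
Hypothesis mu_sum : forall j, (fun N : nat => \sum_(k < N) mu j k) @ \oo --> (1 : R).

Lemma mu_psum_le1 j N : \sum_(k < N) mu j k <= 1.
Proof.
rewrite -(cvg_lim (@Rhausdorff R) (mu_sum j)).
apply: (nondecreasing_cvgn_le (u_ := fun N : nat => \sum_(k < N) mu j k)).
  move=> n m nm; rewrite -!(big_mkord xpredT (mu j)).
  by rewrite [leRHS](big_cat_nat (n := n)) //= lerDl sumr_ge0.
by apply/cvg_ex; exists 1; exact: mu_sum.
Qed.

Lemma mu_le1 j k : mu j k <= 1.
Proof.
apply: le_trans (mu_psum_le1 j k.+1); rewrite big_ord_recr /= lerDr.
by apply: sumr_ge0 => i _.
Qed.

(** A term of positive index and the first one, which is at least as large, add
    up to at most one. Hence [`|ln (mu j k)|] is bounded below by [ln 2] there,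
    which is why the entropy controls the summand [1] of the logarithmic
    condition. *)
Lemma mu_tail_le_half j k : (0 < k)%N -> mu j k <= 2^-1.
Proof.
move=> k0; have := mu_psum_le1 j k.+1; rewrite big_ord_recr /= (bigD1 (Ordinal k0)) //=.
have : 0 <= \sum_(i < k | i != Ordinal k0) mu j i by apply: sumr_ge0.
have := mu_le_head j k; lra.
Qed.

(** By distributivity the product is the sum of the powers
    [p `^ (1 - delta / lnp d)] over the products [p] of one weight per factor, so
    this is a uniform bound on an exponential moment of the information [- ln p]
    scaled by [lnp d]. It is the pivot between tractability and the two
    conditions. *)
Definition bounded_power_products (delta : R) := exists B : R,
  forall (d N : nat), (0 < d)%N ->
  \prod_(j < d) \sum_(k < N) mu j k `^ (1 - delta / lnp d%:R) <= B.

Let excess d delta j k := mu j k `^ (1 - delta / lnp d%:R) - mu j k.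

Lemma slope_itv (delta : R) d : 0 < delta < 1 -> 0 < delta / lnp d%:R < 1.
Proof.
move=> /andP[d0 d1]; have L1 := lnp_ge1 (d%:R : R).
have L0 : 0 < lnp (d%:R : R) by exact: lt_le_trans ltr01 L1.
by rewrite divr_gt0 // ltr_pdivrMr // mul1r (lt_le_trans d1).
Qed.

Lemma excess_ge0 d delta j k : 0 < delta < 1 -> 0 <= excess d delta j k.
Proof.
move=> dd; have /andP[u0 u1] := slope_itv d dd.
by apply: powR_excess_ge0 => //; [exact: mu_le1|rewrite ltW].
Qed.

(** Each factor is a partial sum of the weights plus an excess. Truncating the
    excess at [N] and letting the partial sums tend to one turns the bound into
    one on the product of the [1 + a j], which dominates the sum of the [a j]. *)
Lemma bounded_excess delta : 0 < delta < 1 -> bounded_power_products delta ->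
  exists2 B : R, 0 <= B & forall d N, (0 < d)%N ->
    \sum_(j < d) \sum_(k < N) excess d delta j k <= B.
Proof.
move=> dd [B hB]; have B0 : 0 <= B.
  have := hB 1%N 1%N isT; apply: le_trans.
  by apply: prodr_ge0 => j _; apply: sumr_ge0 => k _; exact: powR_ge0.
exists B => // d N d0; set u := delta / lnp d%:R.
pose a j := \sum_(k < N) excess d delta j k.
have a0 j : 0 <= a j by apply: sumr_ge0 => k _; exact: excess_ge0.
suff : \prod_(j < d) (1 + a j) <= B.
  by have := sum_le_prod1D d a0; rewrite /a; lra.
have lim : (fun N' => \prod_(j < d) (\sum_(k < N') mu j k + a j)) @ \oo -->
    \prod_(j < d) (1 + a j).
  apply: (cvg_prod_fin (F := fun (j : 'I_d) N' => \sum_(k < N') mu j k + a j)) => j.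
  by apply: cvgD; [exact: mu_sum|exact: cvg_cst].
apply: (closed_cvg (fun t : R => t <= B)) lim; first exact: closed_le.
exists N => // N' /= NN'; apply: le_trans (hB d N' d0); apply: ler_prod => j _.
rewrite addr_ge0 ?a0 ?sumr_ge0 //=.
have -> : \sum_(k < N') mu j k `^ (1 - delta / lnp d%:R) =
    \sum_(k < N') mu j k + \sum_(k < N') excess d delta j k.
  by rewrite -big_split; apply: eq_bigr => k _; rewrite /excess /= addrC subrK.
rewrite lerD2l /a -!(big_mkord xpredT (excess d delta j)).
rewrite [leRHS](big_cat_nat (n := N)) //= lerDl.
by apply: sumr_ge0 => k _; exact: excess_ge0.
Qed.

Lemma tail_le_excess d delta j N (F : nat -> R) (c : R) : 0 < delta < 1 ->
  (forall k, (0 < k)%N -> F k <= c * excess d delta j k) -> 0 <= c ->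
  \sum_(1 <= k < N) F k <= c * \sum_(k < N) excess d delta j k.
Proof.
move=> dd hF c0; case: N => [|N].
  by rewrite big_geq // big_ord0 mulr0.
rewrite -(big_mkord xpredT (excess d delta j)) [in leRHS]big_ltn //.
rewrite mulrDr ler_wpDl ?mulr_ge0 ?excess_ge0 // mulr_sumr.
by apply: ler_sum_nat => k /andP[k0 _]; exact: hF.
Qed.

Lemma log_sum_conditionP : log_sum_condition mu <-> exists C : R,
  forall d N, (0 < d)%N -> \sum_(j < d) \sum_(1 <= k < N)
    (1 + `|ln (mu j k)|) * mu j k <= C * lnp d%:R.
Proof.
have f0 j k : 0 <= (1 + `|ln (mu j k)|) * mu j k by rewrite mulr_ge0 // addr_ge0.
have Lp d : 0 < lnp (d%:R : R) := lt_le_trans ltr01 (lnp_ge1 _).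
split=> [h|[C hC]].
  rewrite /log_sum_condition in h.
  set S := ereal_sup _ in h; have [C SC] : exists C : R, (S <= C%:E)%E.
    by case: S h => [r|//|] _; [exists r|exists 0; rewrite leNye].
  exists C => d N d0; move: N; apply/(nnesum_le_iff d _ f0).
  have : ((lnp d%:R)^-1%:E * \sum_(j < d) \sum_(1 <= k <oo)
      ((1 + `|ln (mu j k)|) * mu j k)%:E <= C%:E)%E.
    by apply: le_trans SC; apply: ereal_sup_ubound; exists d.
  by rewrite muleC lee_pdivrMr // EFinM.
apply: (@le_lt_trans _ _ C%:E); last by rewrite ltry.
apply: ge_ereal_sup => _ [d /= d0 <-].
rewrite muleC lee_pdivrMr // -EFinM; apply/(nnesum_le_iff d _ f0) => N; exact: hC.
Qed.

Lemma power_sum_conditionP gamma tau : power_sum_condition mu gamma tau <->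
  exists C : R, forall d N, (0 < d)%N -> \sum_(j < d) \sum_(1 <= k < N)
    mu j k `^ (1 - gamma / lnp d%:R) *
    (mu j k < expR (- tau * lnp d%:R))%R%:R <= C.
Proof.
have f0 d j k : 0 <= mu j k `^ (1 - gamma / lnp d%:R) *
    (mu j k < expR (- tau * lnp d%:R))%R%:R.
  by rewrite mulr_ge0 ?powR_ge0.
split=> [h|[C hC]].
  rewrite /power_sum_condition in h.
  set S := ereal_sup _ in h; have [C SC] : exists C : R, (S <= C%:E)%E.
    by case: S h => [r|//|] _; [exists r|exists 0; rewrite leNye].
  exists C => d N d0; move: N; apply/(nnesum_le_iff d _ (f0 d)).
  by apply: le_trans SC; apply: ereal_sup_ubound; exists d.
apply: (@le_lt_trans _ _ C%:E); last by rewrite ltry.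
apply: ge_ereal_sup => _ [d /= d0 <-].
by apply/(nnesum_le_iff d _ (f0 d)) => N; exact: hC.
Qed.

(** The excess is at least [delta / lnp d] times the entropy term, and the
    entropy term controls the weight itself because the weights with a positive
    index are at most one half. *)
Lemma log_sum_of_products delta : 0 < delta < 1 ->
  bounded_power_products delta -> log_sum_condition mu.
Proof.
move=> dd /(bounded_excess dd)[B B0 hB]; apply/log_sum_conditionP.
have l2 : 0 < ln 2 :> R by rewrite ln_gt0 // ltr1n.
have /andP[delta0 _] := dd.
pose c : R := 1 + (ln 2)^-1; have c0 : 0 <= c by rewrite addr_ge0 ?invr_ge0 ?ltW.
exists (c / delta * B) => d N d0.
have L0 : 0 < lnp (d%:R : R) := lt_le_trans ltr01 (lnp_ge1 _).
have /andP[u0 u1] := slope_itv d dd.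
apply: (@le_trans _ _ (\sum_(j < d) (c / (delta / lnp d%:R) *
    \sum_(k < N) excess d delta j k))).
  apply: ler_sum => j _; apply: tail_le_excess => //; last by rewrite divr_ge0 // ltW.
  move=> k k0; have := powR_excess_ge_log (mu_ge0 j k) (mu_le1 j k) u1.
  rewrite -/(excess d delta j k) => hx.
  rewrite mulrAC ler_pdivlMr //.
  have : mu j k <= (ln 2)^-1 * (mu j k * `|ln (mu j k)|).
    have := mu_ge0 j k; rewrite le_eqVlt => /predU1P[<-|m0].
      by rewrite mul0r mulr0.
    rewrite mulrCA ler_peMr ?(ltW m0) // ler_pdivlMl // mulr1.
    rewrite ler0_norm ?ln_le0 ?mu_le1 // lerNr -lnV ?posrE //.
    by rewrite ler_ln ?posrE ?invr_gt0 //; exact: mu_tail_le_half.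
  move=> hm.
  apply: (@le_trans _ _ (c * (delta / lnp d%:R * (mu j k * `|ln (mu j k)|)))).
    have : (1 + `|ln (mu j k)|) * mu j k <= c * (mu j k * `|ln (mu j k)|).
      by rewrite /c; lra.
    by rewrite -(ler_pM2l u0); lra.
  by rewrite ler_wpM2l.
rewrite -mulr_sumr invf_div.
apply: le_trans (ler_wpM2l _ (hB d N d0)) _.
  by rewrite mulr_ge0 // divr_ge0 // ltW.
by rewrite le_eqVlt; apply/orP; left; apply/eqP; ring.
Qed.

Lemma power_sum_of_products delta tau : 0 < delta < 1 -> 0 < tau ->
  bounded_power_products delta -> power_sum_condition mu delta tau.
Proof.
move=> dd t0 /(bounded_excess dd)[B B0 hB]; apply/power_sum_conditionP.
have /andP[delta0 _] := dd.
pose c : R := 1 - expR (- (delta * tau)).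
have c0 : 0 < c by rewrite subr_gt0 expR_lt1 oppr_lt0 mulr_gt0.
exists (c^-1 * B) => d N d0.
have L0 : 0 < lnp (d%:R : R) := lt_le_trans ltr01 (lnp_ge1 _).
have uu := slope_itv d dd.
apply: (@le_trans _ _ (\sum_(j < d) (c^-1 * \sum_(k < N) excess d delta j k))).
  apply: ler_sum => j _; apply: tail_le_excess => //; last by rewrite invr_ge0 ltW.
  move=> k k0; case: (boolP (mu j k < _)) => [|_]; last first.
    by rewrite mulr0 mulr_ge0 ?invr_ge0 ?(ltW c0) ?excess_ge0.
  rewrite mulr1 mulNr => /(powR_excess_ge_tail (mu_ge0 j k) uu).
  have -> : delta / lnp d%:R * (tau * lnp d%:R) = delta * tau.
    by field; rewrite gt_eqF.
  by rewrite ler_pdivlMl // mulrC.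
by rewrite -mulr_sumr ler_wpM2l ?invr_ge0 ?(ltW c0) // hB.
Qed.

(** The product is at most the exponential of the sum of the excesses. Weights
    below the threshold are handled by the power condition and the others by the
    logarithmic one. The largest weight of each factor, absent from both, has by
    Bernoulli an excess of at most [gamma / lnp d] times the remaining mass, which
    the logarithmic condition bounds. *)
Lemma products_of_sums gamma tau : 0 < gamma < 1 -> 0 < tau ->
  log_sum_condition mu -> power_sum_condition mu gamma tau ->
  bounded_power_products gamma.
Proof.
move=> gg t0 /log_sum_conditionP[C1 h1] /power_sum_conditionP[C2 h2].
have /andP[g0 g1] := gg.
pose c := gamma * expR (gamma * tau).
have c0 : 0 < c by rewrite mulr_gt0 ?expR_gt0.
exists (expR (gamma * C1 + C2 + c * C1)) => d N d0.
have L0 : 0 < lnp (d%:R : R) := lt_le_trans ltr01 (lnp_ge1 _).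
have uu := slope_itv d gg; have /andP[u0 u1] := uu.
set u := gamma / lnp d%:R in uu u0 u1 *.
pose a j := \sum_(k < N.+1) excess d gamma j k.
have a0 j : 0 <= a j by apply: sumr_ge0 => k _; exact: excess_ge0.
have heads : \sum_(j < d) (1 - mu j 0%N) <= C1 * lnp d%:R.
  have lim : (fun n => \sum_(j < d) (\sum_(k < n) mu j k - mu j 0%N)) @ \oo -->
      \sum_(j < d) (1 - mu j 0%N).
    apply: cvg_big => [|j _]; first exact: add_continuous.
    by apply: cvgB; [exact: mu_sum|exact: cvg_cst].
  apply: (closed_cvg (fun t : R => t <= C1 * lnp d%:R)) lim; first exact: closed_le.
  exists 1%N => // n /= n0; apply: le_trans (h1 d n d0); apply: ler_sum => j _.
  rewrite -(big_mkord xpredT (mu j)) big_ltn // addrC addKr.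
  by apply: ler_sum_nat => k _; rewrite ler_peMl // lerDl.
have a_le : \sum_(j < d) a j <= gamma * C1 + C2 + c * C1.
  apply: (@le_trans _ _ (\sum_(j < d) (u * (1 - mu j 0%N) +
     \sum_(1 <= k < N.+1) mu j k `^ (1 - u) * (mu j k < expR (- tau * lnp d%:R))%R%:R +
     c / lnp d%:R * \sum_(1 <= k < N.+1) (1 + `|ln (mu j k)|) * mu j k))).
    apply: ler_sum => j _; rewrite /a -(big_mkord xpredT (excess d gamma j)) big_ltn //.
    rewrite -[leRHS]addrA lerD //;
      first exact: (powR_excess_le_bernoulli (mu_ge0 j 0) uu).
    rewrite mulr_sumr -big_split; apply: ler_sum_nat => k _ /=.
    have r0 : 0 <= c / lnp d%:R * ((1 + `|ln (mu j k)|) * mu j k).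
      by apply: mulr_ge0; [rewrite divr_ge0 // ltW|rewrite mulr_ge0 // addr_ge0].
    case: ltP => [_|hk]; rewrite ?mulr1 ?mulr0 ?add0r.
      by rewrite /excess -/u; have := mu_ge0 j k; lra.
    rewrite mulNr in hk.
    apply: le_trans (powR_excess_le_head (mu_le1 j k) uu hk) _.
    have -> : u * expR (u * (tau * lnp d%:R)) = c / lnp d%:R.
      have -> : u * (tau * lnp d%:R) = gamma * tau by rewrite /u; field; rewrite gt_eqF.
      by rewrite /c /u; ring.
    have cL : 0 <= c / lnp d%:R by rewrite divr_ge0 // ltW.
    by rewrite ler_wpM2l // mulrC ler_wpM2r // lerDr.
  rewrite !big_split /= -!mulr_sumr; apply: lerD; first apply: lerD.
  - apply: le_trans (ler_wpM2l (ltW u0) heads) _.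
    by rewrite le_eqVlt; apply/orP; left; apply/eqP; rewrite /u; field; rewrite gt_eqF.
  - exact: h2.
  - apply: le_trans (ler_wpM2l _ (h1 d N.+1 d0)) _; first by rewrite divr_ge0 // ltW.
    by rewrite le_eqVlt; apply/orP; left; apply/eqP; field; rewrite gt_eqF.
apply: (@le_trans _ _ (\prod_(j < d) (1 + a j))); last first.
  by apply: le_trans (prod1D_le_expR d a0) _; rewrite ler_expR.
apply: ler_prod => j _; rewrite sumr_ge0 => [/=|k _]; last exact: powR_ge0.
apply: (@le_trans _ _ (\sum_(k < N.+1) mu j k `^ (1 - u))).
  by rewrite big_ord_recr /= lerDl powR_ge0.
have -> : \sum_(k < N.+1) mu j k `^ (1 - u) = \sum_(k < N.+1) mu j k + a j.
  by rewrite -big_split; apply: eq_bigr => k _; rewrite /excess /= addrC subrK.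
by rewrite lerD2r mu_psum_le1.
Qed.

End Conditions.

(** * Complexity and products of power sums *)

Lemma prod_powR {R : realType} (I : finType) (x : I -> R) (a : R) :
  (forall i, 0 <= x i) -> \prod_i x i `^ a = (\prod_i x i) `^ a.
Proof.
move=> x0; suff [] : \prod_i x i `^ a = (\prod_i x i) `^ a /\ 0 <= \prod_i x i by [].
elim/big_rec2: _ => [|i y z _ [-> z0]]; first by rewrite powR1.
by rewrite powRM // mulr_ge0.
Qed.

Section Complexity.
Context {R : realType}.
Variable mu : nat -> nat -> R.
Hypothesis mu_ge0 : forall j k, 0 <= mu j k.
Hypothesis mu_sum : forall j, (fun N : nat => \sum_(k < N) mu j k) @ \oo --> (1 : R).
Variable complexity : nat -> R -> \bar R.

Let p d N (k : {ffun 'I_d -> 'I_N}) := \prod_(j < d) mu j (k j).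

Hypothesis complexity_le : forall d N n (A : {set {ffun 'I_d -> 'I_N}}) eps,
  (0 < d)%N -> (0 < n)%N -> 0 < eps < 1 -> (#|A| <= n)%N ->
  1 - eps ^+ 2 <= \sum_(k in A) p k -> (complexity d eps <= n%:R%:E)%E.

Hypothesis complexity_ge : forall d eps c, (0 < d)%N -> 0 < eps < 1 ->
  (complexity d eps <= c%:E)%E -> exists2 n : nat, n%:R <= c + 1 &
  forall N theta, 0 <= theta ->
    \sum_(k : {ffun 'I_d -> 'I_N}) Num.min (p k) theta <= eps ^+ 2 + n%:R * theta.

(** Stated for an abstract complexity subject to the two bounds above, so that what
    follows concerns the weights only; for [approx_complexity] it unfolds to
    [quasi_polynomially_tractable]. *)
Definition quasi_polynomial_bound := exists C s : R, [/\ 0 < C, 0 <= s &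
  forall (d : nat) (eps : R), (0 < d)%N -> 0 < eps < 1 ->
    (complexity d eps <= (C * expR (s * (1 + ln eps^-1) * (1 + ln d%:R)))%:E)%E].

Lemma prod_mu_ge0 d N (k : {ffun 'I_d -> 'I_N}) : 0 <= p k.
Proof. by apply: prodr_ge0 => j _. Qed.

Lemma sum_prod_mu d N :
  \sum_(k : {ffun 'I_d -> 'I_N}) p k = \prod_(j < d) \sum_(k < N) mu j k.
Proof. by rewrite bigA_distr_bigA. Qed.

Lemma sum_prod_mu_le1 d N : \sum_(k : {ffun 'I_d -> 'I_N}) p k <= 1.
Proof.
rewrite sum_prod_mu; apply: (@le_trans _ _ (\prod_(j < d) 1)); last by rewrite big1.
by apply: ler_prod => j _; rewrite sumr_ge0 //= mu_psum_le1.
Qed.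

Lemma sum_prod_powR d N (a : R) : \sum_(k : {ffun 'I_d -> 'I_N}) p k `^ a =
  \prod_(j < d) \sum_(k < N) mu j k `^ a.
Proof.
by rewrite bigA_distr_bigA; apply: eq_bigr => k _; rewrite -prod_powR.
Qed.

(** Take accuracies [expR (- m)]. With [theta m] equal to
    [expR (- 2 * m)] divided by an upper bound for the rank, the lower bound on
    errors says that products [p] not above [theta m] have total mass at most
    [2 * expR (- 2 * m)], an exponential tail for [- ln p]. Summing over the
    layers between consecutive thresholds bounds the exponential moment as soon
    as [delta] is small compared with the decay rate. *)
Lemma products_of_complexity : quasi_polynomial_bound ->
  exists2 delta : R, 0 < delta < 1 & bounded_power_products mu delta.
Proof.
move=> [C [s [C0 s0 hC]]].
pose c := ln (C + 1); have c0 : 0 <= c by rewrite ln_ge0 // lerDr ltW.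
(* D bounds the coefficients of u * z m.+1 below, making the tilt at most 1 + m *)
pose D := c + 4 * s + 3; have D1 : 1 < D by rewrite /D; lra.
have D0 : 0 < D by exact: lt_trans D1.
have Dd : 0 < D^-1 < 1 by rewrite invr_gt0 D0 invf_lt1.
exists D^-1 => //; exists (3 * expR 1) => d N d0; rewrite -sum_prod_powR.
have /andP[u0 u1] := slope_itv d Dd.
set L := lnp _ in u0 u1 *; set u := D^-1 / L in u0 u1 *.
have L1 : 1 <= L := lnp_ge1 _; have L0 : 0 < L by exact: lt_le_trans L1.
pose z (m : nat) := 2 * m%:R + c + 2 * s * L * (1 + m%:R).
pose theta m := expR (- z m).
have z_ge m : m%:R <= z m.
  have : 0 <= 2 * s * L * (1 + m%:R) by rewrite !mulr_ge0 ?addr_ge0 // ltW.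
  by have := ler0n R m; rewrite /z; lra.
have uz m : u * z m.+1 <= 1 + m%:R.
  rewrite /u mulrAC ler_pdivrMr // ler_pdivrMl //.
  have m0 := ler0n R m; rewrite /z /D -natr1.
  have h1 : 0 <= (L - 1) * (c + 3 + (c + 2) * m%:R).
    by rewrite mulr_ge0 ?subr_ge0 // !addr_ge0 ?mulr_ge0 ?addr_ge0.
  have h2 : 0 <= s * L * m%:R by rewrite !mulr_ge0 // ltW.
  have h3 : 0 <= c * m%:R by rewrite mulr_ge0.
  nra.
have small m : \sum_(k : {ffun 'I_d -> 'I_N}) Num.min (p k) (theta m.+1) <=
    2 * expR (- (2 * m.+1%:R)).
  have eps01 : 0 < (expR (- m.+1%:R) : R) < 1.
    by rewrite expR_gt0 expR_lt1 oppr_lt0 ltr0n.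
  have [n nC hn] := complexity_ge d0 eps01 (hC d _ d0 eps01).
  have := hn N (theta m.+1) (expR_ge0 _).
  move=> /le_trans; apply; set x : R := m.+1%:R in nC *.
  have x0 : 0 <= x by exact: ler0n.
  have sqE : expR (- x) ^+ 2 = expR (- (2 * x)).
    by rewrite expr2 -expRD; congr expR; ring.
  have n_le : n%:R <= expR (c + 2 * s * L * (1 + x)).
    apply: le_trans nC _; rewrite -expRN opprK expRK.
    have lnd : 0 <= ln d%:R :> R by rewrite ln_ge0 // ler1n.
    set A := s * (1 + x) * (1 + ln d%:R).
    have A0 : 0 <= A by rewrite !mulr_ge0 // addr_ge0.
    have AL : A <= 2 * s * L * (1 + x).
      rewrite /A (_ : 2 * s * L * (1 + x) = s * (1 + x) * (2 * L)); last by ring.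
      by rewrite ler_wpM2l ?lnp_ge // mulr_ge0 // addr_ge0.
    have e1 : 1 <= expR A by apply: le_trans (expR_ge1Dx _); rewrite lerDl.
    rewrite expRD /c lnK ?posrE ?addr_gt0 //.
    apply: (@le_trans _ _ ((C + 1) * expR A)); first by rewrite mulrDl mul1r lerD2l.
    by rewrite ler_pM2l ?addr_gt0 // ler_expR.
  have : n%:R * theta m.+1 <= expR (- (2 * x)).
    apply: le_trans (ler_wpM2r (expR_ge0 _) n_le) _.
    by rewrite /theta -expRD ler_expR /z -/x; lra.
  by rewrite sqE; lra.
have pointwise (x : R) M : 0 < x -> theta M.+1 < x -> x `^ (1 - u) <=
    x * expR 1 + \sum_(m < M) expR (1 + m.+1%:R) * Num.min x (theta m.+1).
  move=> x0.
  have step m : theta m.+1 < x -> x `^ (1 - u) <= x * expR (1 + m%:R).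
    move=> tx; rewrite powR1B // ler_pM2l // ler_expR.
    apply: le_trans (uz m); rewrite ler_pM2l // lerNl -(expRK (- z _)).
    by rewrite ler_ln ?posrE ?expR_gt0 // ltW.
  elim: M => [|M IH] tx.
    by rewrite big_ord0 addr0; have := step _ tx; rewrite addr0.
  have S0 : 0 <= \sum_(m < M) expR (1 + m.+1%:R) * Num.min x (theta m.+1).
    by apply: sumr_ge0 => m _; rewrite mulr_ge0 ?expR_ge0 // le_min ltW //= expR_ge0.
  rewrite big_ord_recr /= addrA.
  have [xt|tx'] := leP x (theta M.+1).
    apply: le_trans (step _ tx) _; rewrite mulrC lerDr addr_ge0 //.
    by rewrite mulr_ge0 ?expR_ge0 // ltW.
  apply: le_trans (IH tx') _; rewrite lerDl mulr_ge0 ?expR_ge0 //.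
(* holds because 2 <= e *)
have geo M : \sum_(m < M) expR (- m.+1%:R) <= 1 - expR (- M%:R) :> R.
  elim: M => [|M IH]; first by rewrite big_ord0 oppr0 expR0 subrr.
  rewrite big_ord_recr /=.
  have : expR (- M%:R) = expR 1 * expR (- M.+1%:R) :> R.
    by rewrite -expRD -natr1; congr expR; ring.
  have e2 : 2 <= expR 1 :> R by apply: le_trans (expR_ge1Dx 1).
  have := expR_gt0 (- M.+1%:R : R); nra.
(* the box is finite, so one threshold lies below all its positive products *)
pose bnd (k : {ffun 'I_d -> 'I_N}) := Num.bound `|ln (p k)|.
pose M := (\max_k bnd k)%N.
have hM (k : {ffun 'I_d -> 'I_N}) : 0 < p k -> theta M.+1 < p k.
  move=> pk; rewrite -[ltRHS](lnK (x := p k)) ?posrE // ltr_expR ltrNl.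
  apply: le_lt_trans (ler_norm _) _; rewrite normrN.
  apply: lt_le_trans (archi_boundP (normr_ge0 _)) _; apply: le_trans (z_ge _).
  by rewrite ler_nat; apply: leqW; exact: (@leq_bigmax _ bnd k).
apply: (@le_trans _ _ (\sum_k (p k * expR 1 +
    \sum_(m < M) expR (1 + m.+1%:R) * Num.min (p k) (theta m.+1)))).
  apply: ler_sum => k _; have := prod_mu_ge0 k; rewrite le_eqVlt => /predU1P[<-|pk].
    rewrite powR1B_0 // mul0r add0r; apply: sumr_ge0 => m _.
    by rewrite mulr_ge0 ?expR_ge0 // le_min lexx expR_ge0.
  by apply: pointwise => //; exact: hM.
rewrite big_split /= -mulr_suml exchange_big /=.
have h1 : (\sum_(k : {ffun 'I_d -> 'I_N}) p k) * expR 1 <= expR 1.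
  by rewrite ler_piMl ?expR_ge0 // sum_prod_mu_le1.
have h2 : \sum_(m < M) \sum_(k : {ffun 'I_d -> 'I_N})
    expR (1 + m.+1%:R) * Num.min (p k) (theta m.+1) <= 2 * expR 1.
  apply: (@le_trans _ _ (\sum_(m < M) 2 * expR 1 * expR (- m.+1%:R))).
    apply: ler_sum => m _; rewrite -mulr_sumr.
    apply: le_trans (ler_wpM2l (expR_ge0 _) (small m)) _.
    rewrite mulrCA -!mulrA ler_pM2l // -!expRD ler_expR; lra.
  rewrite -mulr_sumr ler_piMr ?mulr_ge0 ?expR_ge0 //.
  by apply: le_trans (geo M) _; rewrite gerBl expR_ge0.
lra.
Qed.

(** A Chebyshev argument: keep the products above a threshold [theta]. The mass
    below it is at most [theta `^ u * B], and at most [B / theta] products lie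
    above; [theta] is chosen to make the former [eps ^+ 2 / 2]. The other half of
    [eps ^+ 2] pays for truncating to a finite box. *)
Lemma complexity_of_products delta : 0 < delta < 1 ->
  bounded_power_products mu delta -> quasi_polynomial_bound.
Proof.
move=> dd [B0 hB0]; have /andP[delta0 _] := dd.
pose B := Num.max B0 1.
have B1 : 1 <= B by rewrite le_max lexx orbT.
have Bp : 0 < B by exact: lt_le_trans B1.
have hB d N : (0 < d)%N ->
    \prod_(j < d) \sum_(k < N) mu j k `^ (1 - delta / lnp d%:R) <= B.
  by move=> d0; rewrite le_max hB0.
pose b := ln (2 * B); have b0 : 0 <= b by rewrite ln_ge0 //; lra.
exists (2 * B), ((2 + b) / delta); split; first by rewrite mulr_gt0.
  by rewrite divr_ge0 ?addr_ge0 // ltW.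
move=> d eps d0 /[dup] eps01 /andP[eps0 eps1].
have /andP[u0 u1] := slope_itv d dd.
have := hB d; set L := lnp _ in u0 u1 *; set u := delta / L in u0 u1 *.
move=> /(_ _ d0) hBd; have L1 : 1 <= L := lnp_ge1 _.
have L0 : 0 < L by exact: lt_le_trans L1.
pose t := ln eps^-1; have epsE : eps = expR (- t).
  by rewrite /t lnV ?posrE // opprK lnK ?posrE.
have t0 : 0 <= t by rewrite ln_ge0 // invf_ge1 // ltW.
pose theta := expR (- ((2 * t + b) / u)).
have theta0 : 0 < theta by exact: expR_gt0.
have eps20 : 0 < eps ^+ 2 / 2 by rewrite divr_gt0 ?exprn_gt0.
have /cvgrPdist_lt/(_ _ eps20)[N _ /(_ N (leqnn N)) /=] :
    (fun N => \prod_(j < d) \sum_(k < N) mu j k) @ \oo --> \prod_(j < d) (1 : R).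
  by apply: (cvg_prod_fin (F := fun (j : 'I_d) N => \sum_(k < N) mu j k)).
rewrite big1 // -sum_prod_mu => /(le_lt_trans (ler_norm _)) hN.
have p1 (k : {ffun 'I_d -> 'I_N}) : p k <= 1.
  apply: le_trans (sum_prod_mu_le1 d N); rewrite (bigD1 k) //= lerDl.
  by apply: sumr_ge0 => l _; exact: prod_mu_ge0.
have sum_pow : \sum_(k : {ffun 'I_d -> 'I_N}) p k `^ (1 - u) <= B.
  by rewrite sum_prod_powR; exact: hBd.
pose A := [set k : {ffun 'I_d -> 'I_N} | theta < p k]%SET.
have tail : \sum_(k | k \notin A) p k <= eps ^+ 2 / 2.
  apply: (@le_trans _ _ (\sum_k expR (- (2 * t + b)) * p k `^ (1 - u))).
    rewrite big_mkcond; apply: ler_sum => k _; case: ifPn => [|_]; last first.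
      by rewrite mulr_ge0 ?expR_ge0 ?powR_ge0.
    rewrite inE -leNgt => pk; have := prod_mu_ge0 k; rewrite le_eqVlt => /predU1P[<-|pk0].
      by rewrite powR1B_0 // mulr0.
    rewrite powR1B // mulrCA -expRD ler_peMr ?(ltW pk0) //.
    apply: le_trans (expR_ge1Dx _); rewrite lerDl.
    have : (2 * t + b) / u <= - ln (p k).
      by rewrite lerNr -(expRK (- (_ / _))) ler_ln ?posrE ?expR_gt0.
    by rewrite ler_pdivrMr //; lra.
  rewrite -mulr_sumr opprD expRD (_ : expR (- (2 * t)) = eps ^+ 2); last first.
    by rewrite epsE expr2 -expRD; congr expR; ring.
  rewrite expRN /b lnK ?posrE ?mulr_gt0 // -mulrA ler_pM2l ?exprn_gt0 //.
  by rewrite ler_pdivrMl ?mulr_gt0 //; lra.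
have head : 1 - eps ^+ 2 <= \sum_(k in A) p k.
  by move: hN; rewrite (bigID (mem A)) /=; move: tail; lra.
have cardA : #|A|%:R * theta <= B.
  apply: le_trans sum_pow.
  have -> : #|A|%:R * theta = \sum_(k in A) theta by rewrite sumr_const mulr_natl.
  rewrite big_mkcond; apply: ler_sum => k _; case: ifPn => [|_]; last exact: powR_ge0.
  rewrite inE => /ltW/le_trans; apply.
  by rewrite -subr_ge0 powR_excess_ge0 ?prod_mu_ge0 ?p1 // u1 ltW.
apply: le_trans (complexity_le d0 (ltn0Sn #|A|) eps01 (leqnSn _) head) _.
rewrite lee_fin -/t -natr1.
have theta1 : theta <= 1.
  by rewrite /theta -(expR0 R) ler_expR oppr_le0 divr_ge0 ?(ltW u0) //
    addr_ge0 // mulr_ge0.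
apply: (@le_trans _ _ (2 * B * theta^-1)).
  by rewrite ler_pdivlMr // mulrDl mul1r; lra.
rewrite ler_pM2l ?mulr_gt0 // -expRN opprK ler_expR.
have d1 : 1 <= d%:R :> R by rewrite ler1n.
have -> : (2 * t + b) / u = (2 * t + b) * L / delta by rewrite /u; field; rewrite !gt_eqF.
have -> : (2 + b) / delta * (1 + t) * (1 + ln d%:R) =
    (2 + b) * (1 + t) * (1 + ln d%:R) / delta by ring.
rewrite ler_pM2r ?invr_gt0 // ler_pM ?lnp_le // ?(ltW L0) //.
  by rewrite addr_ge0 // mulr_ge0.
have : 0 <= b * t by rewrite mulr_ge0.
lra.
Qed.

End Complexity.

(** * The criterion *)

Local Close Scope classical_set_scope.
Unset Implicit Arguments.

Theorem theorem2 (R : realType)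
  (H1 : nat -> sepHilbertType R) (X1 : forall j : nat, random_element (H1 j))
  (K1 : forall j : nat, H1 j -> H1 j)
  (hK1 : forall j : nat, covariance_operator (X1 j) (K1 j))
  (lam : nat -> nat -> R)
  (hlam : forall j : nat, eigenvalue_sequence (K1 j) (lam j))
  (hlam_pos : forall j : nat, 0 < lam j 0%N)
  (H : nat -> sepHilbertType R)
  (T : forall d : nat, (forall j : 'I_d, H1 j) -> H d)
  (hT : forall d : nat, (0 < d)%N -> hilbert_tensor_product (T d))
  (X : forall d : nat, random_element (H d))
  (K : forall d : nat, H d -> H d)
  (hK : forall d : nat, (0 < d)%N -> covariance_operator (X d) (K d))
  (hKT : forall (d : nat) (x : forall j : 'I_d, H1 j), (0 < d)%N ->
     K d (T d x) = T d (fun j : 'I_d => K1 j (x j))) :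
  let mu := fun j : nat => normalized (lam j) in
  (quasi_polynomially_tractable X <->
   log_sum_condition mu /\
   exists gamma tau : R,
     [/\ 0 < gamma < 1, 0 < tau & power_sum_condition mu gamma tau]) /\
  (quasi_polynomially_tractable X <->
   log_sum_condition mu /\
   exists gamma : R, 0 < gamma < 1 /\
     forall tau : R, 0 < tau -> power_sum_condition mu gamma tau).
Proof.
move=> mu.
pose L j := second_moment (X1 j).
have lam_cvg j : (series (lam j) @ \oo --> L j)%classic.
  exact: eigenvalue_series_cvg (hK1 j) (hlam j).
have lam_ge0 j k : 0 <= lam j k.
  exact: eigenvalue_ge0 (covariance_psd (hK1 j)) (hlam j) k.
have LE j : limn (series (lam j)) = L j := cvg_lim (@Rhausdorff R) (lam_cvg j).
have L0 j : 0 < L j.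
  have [u [uO Ku u1]] := eigensystem_exists (covariance_psd (hK1 j)) (hlam j).
  have := eigen_series_le (covariance_has_trace (hK1 j)) uO Ku u1 1.
  by apply: lt_le_trans; rewrite /series /= big_nat1.
have mu_ge0 j k : 0 <= mu j k by rewrite /mu /normalized LE divr_ge0 // ltW.
have mu_le_head j k : mu j k <= mu j 0%N.
  by rewrite /mu /normalized LE ler_pM2r ?invr_gt0 //; apply: (hlam j).1.
have mu_sum j : (\sum_(k < N) mu j k @[N --> \oo] --> (1 : R))%classic.
  have -> : (fun N => \sum_(k < N) mu j k) = (fun N => series (lam j) N / L j).
    apply/funext => N; rewrite /series /= mulr_suml big_mkord.
    by apply: eq_bigr => k _; rewrite /mu /normalized LE.
  by rewrite -(divff (lt0r_neq0 (L0 j))); apply: cvgM => //; exact: cvg_cst.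
have prodE d N (k : {ffun 'I_d -> 'I_N}) :
    \prod_(j < d) lam j (k j) = (\prod_(j < d) mu j (k j)) * \prod_(j < d) L j.
  rewrite -big_split; apply: eq_bigr => j _ /=.
  by rewrite /mu /normalized LE divfK ?gt_eqF.
have PL0 d : 0 < \prod_(j < d) L j by apply: prodr_gt0 => j _.
pose complexity d := approx_complexity (X d).
have complexity_le d N n (A : {set {ffun 'I_d -> 'I_N}}) eps : (0 < d)%N -> (0 < n)%N ->
    0 < eps < 1 -> (#|A| <= n)%N ->
    1 - eps ^+ 2 <= \sum_(k in A) \prod_(j < d) mu j (k j) ->
    (complexity d eps <= n%:R%:E)%E.
  move=> d0 n0 /andP[eps0 _] An hA; apply: ereal_inf_lbound; exists n => //; split=> //.
  apply: (tensor_error_le (hT d d0) (fun j : 'I_d => hK1 j) (fun j : 'I_d => hlam j)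
    (hK d d0) (fun x => hKT d x d0) (ltW eps0) An).
  by rewrite (eq_bigr _ (fun k _ => prodE d N k)) -mulr_suml ler_pM2r.
have complexity_ge d eps c : (0 < d)%N -> 0 < eps < 1 -> (complexity d eps <= c%:E)%E ->
    exists2 n : nat, n%:R <= c + 1 & forall N theta, 0 <= theta ->
    \sum_(k : {ffun 'I_d -> 'I_N}) Num.min (\prod_(j < d) mu j (k j)) theta <=
      eps ^+ 2 + n%:R * theta.
  move=> d0 /andP[eps0 _] hc.
  have /ereal_inf_lt[_ [n [n0 err] <-]] : (complexity d eps < (c + 1)%:E)%E.
    by apply: le_lt_trans hc _; rewrite lte_fin ltrDl.
  rewrite lte_fin => nc; exists n; first exact: ltW.
  move=> N theta t0.
  have := tensor_error_ge (hT d d0) (fun j : 'I_d => hK1 j) (fun j : 'I_d => hlam j)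
    (hK d d0) (fun x => hKT d x d0) (n := n) N (ltW eps0)
    (mulr_ge0 t0 (ltW (PL0 d))) err.
  have minE (k : {ffun 'I_d -> 'I_N}) :
      Num.min (\prod_(j < d) lam j (k j)) (theta * \prod_(j < d) L j) =
      Num.min (\prod_(j < d) mu j (k j)) theta * \prod_(j < d) L j.
    by rewrite prodE minr_pMl ?ltW.
  rewrite (eq_bigr _ (fun k _ => minE k)).
  by rewrite -mulr_suml mulrA -mulrDl ler_pM2r.
have qpt_products := products_of_complexity mu_ge0 mu_sum complexity_ge.
have products_qpt delta := complexity_of_products mu_ge0 mu_sum complexity_le
  (delta := delta).
have products_log delta := log_sum_of_products mu_ge0 mu_le_head mu_sum (delta := delta).
have products_pow delta tau := power_sum_of_products mu_ge0 mu_sum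
  (delta := delta) (tau := tau).
have sums_products gamma tau := products_of_sums mu_ge0 mu_sum
  (gamma := gamma) (tau := tau).
split; split.
- move=> /qpt_products[delta dd hB]; split; first exact: products_log hB.
  by exists delta, 1; split=> //; exact: products_pow.
- move=> [hlog [gamma [tau [gg t0 hpow]]]].
  exact: products_qpt gg (sums_products _ _ gg t0 hlog hpow).
- move=> /qpt_products[delta dd hB]; split; first exact: products_log hB.
  by exists delta; split=> // tau t0; exact: products_pow.
- move=> [hlog [gamma [gg hpow]]].
  exact: products_qpt gg (sums_products _ _ gg ltr01 hlog (hpow 1 ltr01)).
Qed.
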